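(* Let $G=(V,D,B)$ be a mixed graph. (a) If there are a family $(Y_v:v\in V)$ with each $Y_v$ satisfying the weak half-trek criterion with respect to $v$ and a total ordering $\prec$ on $V$ with $w\prec v$ whenever $w\in Y_v\cap\mathrm{htr}(v)$, then $G$ is rationally identifiable; moreover such a family and ordering exist if and only if $G$ is HTC-identifiable. (b) If every family $(Y_v:v\in V)$ of subsets of $V$ either contains a $Y_v$ not satisfying the weak half-trek criterion with respect to $v$ or contains a pair $Y_v,Y_w$ with $v\in Y_w$ and $w\in Y_v$, then $\phi_G$ is generically infinite-to-one; moreover this condition holds if and only if $G$ is HTC-infinite-to-one.
   Context: A mixed graph is $G=(V,D,B)$ with $V=[m]$, $D\subseteq V\times V$ directed edges $v\to w$, $B$ symmetric set of bidirected edges $v\leftrightarrow w$, no self-loops. $\mathrm{pa}(v)=\{w:w\to v\in D\}$, $\mathrm{sib}(v)=\{w:w\leftrightarrow v\in B\}$. $\mathbb{R}^D_{\mathrm{reg}}$: real $m\times m$ $\Lambda$ with $\lambda_{vw}=0$ for $v\to w\notin D$ and $I-\Lambda$ invertible; $\mathrm{PD}(B)$: positive definite symmetric $\Omega$ with $\omega_{vw}=0$ for $v\ne w$, $v\leftrightarrow w\notin B$; $\Theta=\mathbb{R}^D_{\mathrm{reg}}\times\mathrm{PD}(B)$; $\phi_G(\Lambda,\Omega)=(I-\Lambda)^{-T}\Omega(I-\Lambda)^{-1}$. A proper algebraic subset of $\Theta$ is the zero set in $\Theta$ of polynomials in the entries, not all of $\Theta$. $G$ is rationally identifiable if there exist a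 proper algebraic subset $W$ and a rational map $\psi$ with $\psi\circ\phi_G=\mathrm{id}$ on $\Theta\setminus W$. $\phi_G$ is generically infinite-to-one if its fibers $\{(\Lambda',\Omega')\in\Theta:\phi_G(\Lambda',\Omega')=\phi_G(\Lambda,\Omega)\}$ are infinite for all $(\Lambda,\Omega)$ outside a proper algebraic subset. A path is a sequence of edges of $D\cup B$ connecting consecutive nodes (not necessarily simple; directed edges traversable either way). A trek from $v$ to $w$ is a path $v=v^L_l\leftarrow\cdots\leftarrow v^L_0\leftrightarrow v^R_0\to\cdots\to v^R_r=w$ with $\mathrm{Left}=\{v^L_0,\dots,v^L_l\}$, $\mathrm{Right}=\{v^R_0,\dots,v^R_r\}$, or $v=v^L_l\leftarrow\cdots\leftarrow v^L_1\leftarrow v^T\to v^R_1\to\cdots\to v^R_r=w$ ($l,r\ge0$) with $\mathrm{Left}=\{v^T,v^L_1,\dots\}$, $\mathrm{Right}=\{v^T,v^R_1,\dots\}$. A half-trek is a trek with $|\mathrm{Left}|=1$. A system of treks from $X$ to $Y$: treks with distinct sources forming $X$ and distinct targets forming $Y$; no sided intersection: Left sets pairwise disjoint and Right sets pairwise disjoint. $\mathrm{htr}(v)$: set of $w\in V\setminus(\{v\}\cup\mathrm{sib}(v))$ reachable from $v$ by a half-trek. $Y$ satisfies the half-trek criterion w.r.t. $v$ if (i) $|Y|=|\mathrm{pa}(v)|$, (ii) $Y\cap(\{v\}\cup\mathrm{sib}(v))=\emptyset$, (iii) there is a system of half-treks with no sided intersection from $Y$ to $\mathrm{pa}(v)$;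 it satisfies the weak half-trek criterion if (i), (ii) hold and there is a system of treks with no sided intersection from $Y$ to $\mathrm{pa}(v)$ in which the trek from each $w\in Y\cap\mathrm{htr}(v)$ is a half-trek. $G$ is HTC-identifiable if there exist a family $(Y_v)$, each satisfying the half-trek criterion w.r.t. $v$, and a total order $\prec$ with $w\prec v$ whenever $w\in Y_v\cap\mathrm{htr}(v)$. $G$ is HTC-infinite-to-one if every family $(Y_v:v\in V)$ either contains some $Y_v$ failing the half-trek criterion w.r.t. $v$ or contains a pair with $v\in Y_w$, $w\in Y_v$. *)

(* Defs.v *)
From HB Require Import structures.
From mathcomp Require Import all_boot all_order all_algebra.
Set Implicit Arguments. Unset Strict Implicit. Unset Printing Implicit Defensive.
Import Order.TTheory GRing.Theory Num.Theory.
Local Open Scope ring_scope.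

(* G = (V, D, B) with V = 'I_m; D v w means the directed edge v -> w;
   B v w means the bidirected edge v <-> w. *)
Definition mixed_graph (m : nat) (D B : rel 'I_m) : Prop :=
  irreflexive D /\ irreflexive B /\ symmetric B.

Definition pa (m : nat) (D : rel 'I_m) (v : 'I_m) : {set 'I_m} := [set w | D w v].
Definition sib (m : nat) (B : rel 'I_m) (v : 'I_m) : {set 'I_m} := [set w | B w v].

(* A trek is ((lt, ls), (rt, rs)): the left side is the sequence lt :: ls,
   a directed path lt -> ... -> last lt ls (= source), the right side is
   rt :: rs, a directed path rt -> ... -> last rt rs (= target); either
   lt = rt (= v^T, the top node) or lt <-> rt (= v^L_0 <-> v^R_0). *)
Definition trek (m : nat) : Type := ('I_m * seq 'I_m) * ('I_m * seq 'I_m).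

Definition trek_left (m : nat) (t : trek m) : seq 'I_m := t.1.1 :: t.1.2.
Definition trek_right (m : nat) (t : trek m) : seq 'I_m := t.2.1 :: t.2.2.
Definition trek_src (m : nat) (t : trek m) : 'I_m := last t.1.1 t.1.2.
Definition trek_tgt (m : nat) (t : trek m) : 'I_m := last t.2.1 t.2.2.

Definition is_trek (m : nat) (D B : rel 'I_m) (t : trek m) : bool :=
  [&& path D t.1.1 t.1.2, path D t.2.1 t.2.2 & ((t.1.1 == t.2.1) || B t.1.1 t.2.1)].

Definition is_halftrek (m : nat) (t : trek m) : bool :=
  size (undup (trek_left t)) == 1%N.

Definition htr (m : nat) (D B : rel 'I_m) (v w : 'I_m) : Prop :=
  w \notin v |: sib B v /\
  exists t : trek m, [/\ is_trek D B t, is_halftrek t, trek_src t = v & trek_tgt t = w].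

Definition trek_system_nsi (m : nat) (D B : rel 'I_m) (X Y : {set 'I_m})
    (ts : seq (trek m)) : Prop :=
  [/\ all (is_trek D B) ts,
      uniq (map (@trek_src m) ts) /\ [set x in map (@trek_src m) ts] = X,
      uniq (map (@trek_tgt m) ts) /\ [set x in map (@trek_tgt m) ts] = Y,
      pairwise (fun t1 t2 => [disjoint trek_left t1 & trek_left t2]) ts
    & pairwise (fun t1 t2 => [disjoint trek_right t1 & trek_right t2]) ts].

Definition HTC (m : nat) (D B : rel 'I_m) (v : 'I_m) (Y : {set 'I_m}) : Prop :=
  [/\ #|Y| = #|pa D v|, Y :&: (v |: sib B v) = set0 &
      exists ts, trek_system_nsi D B Y (pa D v) ts /\
                 forall t, t \in ts -> is_halftrek t].

Definition weak_HTC (m : nat) (D B : rel 'I_m) (v : 'I_m) (Y : {set 'I_m}) : Prop :=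
  [/\ #|Y| = #|pa D v|, Y :&: (v |: sib B v) = set0 &
      exists ts, trek_system_nsi D B Y (pa D v) ts /\
                 forall t, t \in ts -> trek_src t \in Y ->
                   htr D B v (trek_src t) -> is_halftrek t].

Definition strict_total_order (m : nat) (r : rel 'I_m) : Prop :=
  [/\ irreflexive r, transitive r & forall v w, v != w -> r v w || r w v].

Definition HTC_identifiable (m : nat) (D B : rel 'I_m) : Prop :=
  exists (Y : 'I_m -> {set 'I_m}) (prec : rel 'I_m),
    [/\ strict_total_order prec, forall v, HTC D B v (Y v) &
        forall v w, w \in Y v -> htr D B v w -> prec w v].

Definition weak_HTC_identifiable (m : nat) (D B : rel 'I_m) : Prop :=
  exists (Y : 'I_m -> {set 'I_m}) (prec : rel 'I_m),
    [/\ strict_total_order prec, forall v, weak_HTC D B v (Y v) &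
        forall v w, w \in Y v -> htr D B v w -> prec w v].

Definition HTC_infinite_to_one (m : nat) (D B : rel 'I_m) : Prop :=
  forall Y : 'I_m -> {set 'I_m},
    (exists v, ~ HTC D B v (Y v)) \/
    (exists v w, [/\ v != w, v \in Y w & w \in Y v]).

Definition weak_HTC_infinite_to_one (m : nat) (D B : rel 'I_m) : Prop :=
  forall Y : 'I_m -> {set 'I_m},
    (exists v, ~ weak_HTC D B v (Y v)) \/
    (exists v w, [/\ v != w, v \in Y w & w \in Y v]).

Inductive mpoly (R : Type) (X : Type) : Type :=
| MPconst of R
| MPvar of X
| MPadd of mpoly R X & mpoly R X
| MPmul of mpoly R X & mpoly R X.

Fixpoint meval (R : ringType) (X : Type) (e : X -> R) (p : mpoly R X) : R :=
  match p with
  | MPconst c => c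
  | MPvar x => e x
  | MPadd p q => meval e p + meval e q
  | MPmul p q => meval e p * meval e q
  end.

Definition in_RDreg (R : rcfType) (m : nat) (D : rel 'I_m) (L : 'M[R]_m) : Prop :=
  (forall v w, ~~ D v w -> L v w = 0) /\ (1%:M - L) \in unitmx.

Definition in_PD (R : rcfType) (m : nat) (B : rel 'I_m) (O : 'M[R]_m) : Prop :=
  [/\ O^T = O,
      (forall v w, v != w -> ~~ B v w -> O v w = 0) &
      forall x : 'cV[R]_m, x != 0 -> 0 < (x^T *m O *m x) ord0 ord0].

Definition in_Theta (R : rcfType) (m : nat) (D B : rel 'I_m) (L O : 'M[R]_m) : Prop :=
  in_RDreg D L /\ in_PD B O.

Definition phiG (R : rcfType) (m : nat) (L O : 'M[R]_m) : 'M[R]_m :=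
  (invmx (1%:M - L))^T *m O *m invmx (1%:M - L).

Definition param_var (m : nat) : Type := ('I_m * 'I_m + 'I_m * 'I_m)%type.

Definition param_coord (R : rcfType) (m : nat) (L O : 'M[R]_m) (x : param_var m) : R :=
  match x with inl (v, w) => L v w | inr (v, w) => O v w end.

Definition outside_alg (R : rcfType) (m : nat) (Ws : seq (mpoly R (param_var m)))
    (L O : 'M[R]_m) : bool :=
  has (fun p => meval (param_coord L O) p != 0) Ws.

Definition proper_alg (R : rcfType) (m : nat) (D B : rel 'I_m)
    (Ws : seq (mpoly R (param_var m))) : Prop :=
  exists L O, in_Theta D B L O /\ outside_alg Ws L O.

Definition matrix_coord (R : rcfType) (m : nat) (S : 'M[R]_m) (x : 'I_m * 'I_m) : R :=
  S x.1 x.2.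

Definition rationally_identifiable (R : rcfType) (m : nat) (D B : rel 'I_m) : Prop :=
  exists (Ws : seq (mpoly R (param_var m)))
         (psi : param_var m -> mpoly R ('I_m * 'I_m) * mpoly R ('I_m * 'I_m)),
    proper_alg D B Ws /\
    forall L O, in_Theta D B L O -> outside_alg Ws L O ->
      forall x, let S := phiG L O in
        meval (matrix_coord S) (psi x).2 != 0 /\
        meval (matrix_coord S) (psi x).1 / meval (matrix_coord S) (psi x).2
          = param_coord L O x.

Definition infinite_pred (T : eqType) (P : T -> Prop) : Prop :=
  forall s : seq T, exists x, P x /\ x \notin s.

Definition generically_infinite_to_one (R : rcfType) (m : nat) (D B : rel 'I_m) : Prop :=
  exists Ws : seq (mpoly R (param_var m)),
    proper_alg D B Ws /\
    forall L O, in_Theta D B L O -> outside_alg Ws L O ->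
      infinite_pred (fun LO : 'M[R]_m * 'M[R]_m =>
        in_Theta D B LO.1 LO.2 /\ phiG LO.1 LO.2 = phiG L O).

(* Main.v *)
Require Import Defs.
From HB Require Import structures.
From mathcomp Require Import all_boot all_order all_algebra.
From mathcomp Require Import fingroup perm ring lra.
From mathcomp Require Import polyrcf ordered_qelim.
From mathcomp Require qe_rcf.
From Stdlib Require Import Classical.
Set Implicit Arguments. Unset Strict Implicit. Unset Printing Implicit Defensive.
Import Order.TTheory GRing.Theory Num.Theory.
Local Open Scope ring_scope.

(* Cutting the treks of a weak half-trek system at their tops leaves half-treks
   and does not change [Y v] inside [htr v], which reduces everything to the
   half-trek criterion. Write S = phiG L O and H = O (1 - L)^-1 = (1 - L)^T S. A
   nonzero minor of H yields a half-trek system without sided intersection, and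
   conversely such a system makes the minor nonzero at some point.

   Identifiability: column v of L solves linear equations whose rows are H y for
   y in [Y v] inside [htr v], and S y for all y that v does not reach. Solved
   along the order by normal equations, these are rational in S.

   Infinite fibers: if no admissible family [Y] exists, the differential of
   [phiG] has at every point a kernel vector with nonzero L-part. Differentiating
   relations along such vectors shows that for some edge u -> v the entry L u v
   is transcendental over the functions of S. By quantifier elimination, the set
   of values of L u v on the fiber over S is described by signs of polynomials in
   S and L u v; generically those that do not vanish identically are nonzero at
   the given point, so the set contains an interval: no implicit function theorem
   over a general real closed field is needed. *)

(** * Half-treks and the weak half-trek criterion *)

Section HalfTreks.

Variables (m : nat) (D B : rel 'I_m).
Hypothesis symB : symmetric B.
Implicit Types (v w : 'I_m) (Y : {set 'I_m}) (t : trek m).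

(** Targets in [v |: sib B v] are allowed here, unlike in [htr]. This makes the relation stable
    under appending directed paths. *)
Definition hreach v w : bool := [exists r, ((v == r) || B v r) && connect D r w].

(** [is_halftrek] counts distinct nodes, so the left side may be a longer sequence repeating one
    node; its first and last entries agree in any case. *)
Lemma halftrek_src t : is_halftrek t -> trek_src t = t.1.1.
Proof.
case: t => [[a s] r]; rewrite /is_halftrek /trek_src /trek_left => /eqP h1 /=.
case E: (undup _) h1 => [|x [|y l]] // _.
have : a \in undup (a :: s) by rewrite mem_undup mem_head.
have : last a s \in undup (a :: s) by rewrite mem_undup mem_last.
by rewrite E !inE => /eqP -> /eqP ->.
Qed.

Lemma htrP v w : htr D B v w <-> (w \notin v |: sib B v) /\ hreach v w.
Proof.
split=> [[nw [t [tt th tv tw]]]|[nw /existsP[r /andP[vr /connectP[s ps lw]]]]]; split=> //.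
  apply/existsP; exists t.2.1.
  case/and3P: tt => _ pr ab; rewrite -tv halftrek_src // ab /=.
  by apply/connectP; exists t.2.2.
exists ((v, [::]), (r, s)); split=> //.
by rewrite /is_trek /= ps.
Qed.

Lemma hreach_trans v w u : hreach v w -> connect D w u -> hreach v u.
Proof.
move=> /existsP[r /andP[vr rw]] wu; apply/existsP; exists r.
by rewrite vr (connect_trans rw wu).
Qed.

Lemma hreach_near v w u : w \in v |: sib B v -> connect D w u -> hreach v u.
Proof.
rewrite !inE => vw wu; apply/existsP; exists w.
by rewrite symB eq_sym vw.
Qed.

Lemma HTC_weak v Y : HTC D B v Y -> weak_HTC D B v Y.
Proof.
move=> [h1 h2 [ts [h3 h4]]]; split=> //; exists ts; split=> // t t_in _ _.
exact: h4.
Qed.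

(** The half-trek out of [w] ends in a parent of [v], and one more edge reaches [v]. *)
Lemma HTC_htr v w Y : HTC D B v Y -> w \in Y -> htr D B w v.
Proof.
move=> [_ dY [ts [[all_t [us eY] [ut eP] _ _] hts]]] wY; apply/htrP; split.
  apply/negP => vw; have : w \in Y :&: (v |: sib B v).
    by move: vw; rewrite !inE wY eq_sym symB.
  by rewrite dY inE.
move: wY; rewrite -eY inE => /mapP[t t_in ->].
have tp : trek_tgt t \in pa D v by rewrite -eP inE map_f.
move: tp; rewrite inE => /connect1 tv; apply: hreach_trans tv.
have /and3P[_ pr ab] := allP all_t _ t_in.
apply/existsP; exists t.2.1; rewrite halftrek_src ?hts // ab /=.
by apply/connectP; exists t.2.2.
Qed.

Definition crop_left t : trek m := ((t.1.1, [::]), t.2).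

(* The trek from a source [y] outside [htr v] is cut at its top: since [y] is a
   descendant of the top, the top is not in [v |: sib v], nor in [htr v]. *)
Lemma weak_HTC_crop v Y : weak_HTC D B v Y ->
  exists Y', HTC D B v Y' /\ forall w, w \in Y' -> htr D B v w -> w \in Y.
Proof.
move=> [cY dY [ts [[all_t [us eY] [ut eP] dl dr] hts]]].
pose Y' := [set x in [seq t.1.1 | t <- ts]].
have top_conn t : t \in ts -> connect D t.1.1 (trek_src t).
  by move=> /(allP all_t)/and3P[p1 _ _]; apply/connectP; exists t.1.2.
have srcY t : t \in ts -> trek_src t \in Y by move=> h; rewrite -eY inE map_f.
(* Since [Y] avoids [v |: sib B v], a source that [v] reaches lies in [htr v]. Its trek is then a
   half-trek, and cropping leaves the source in place. *)
have near t : t \in ts -> hreach v (trek_src t) -> trek_src t = t.1.1.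
  move=> t_in vr; apply: halftrek_src; apply: hts => //; first exact: srcY.
  apply/htrP; split=> //; apply/negP=> h.
  have : trek_src t \in Y :&: (v |: sib B v) by rewrite inE srcY.
  by rewrite dY inE.
have usrc : uniq [seq t.1.1 | t <- ts].
  elim: (ts) (dl) => //= t s IH /andP[ht hs]; rewrite IH // andbT.
  apply/mapP => -[t' t'_in e]; move/allP: ht => /(_ _ t'_in) /=.
  rewrite disjoint_sym => /pred0P /(_ t.1.1).
  by rewrite /= {1}e !inE !eqxx.
exists Y'; split; last first.
  move=> w; rewrite inE => /mapP[t t_in ->] /htrP[_ hr].
  by rewrite -near ?srcY //; apply: hreach_trans hr (top_conn _ t_in).
split.
- rewrite -cY -eY /Y' !cardsE.
  have /card_uniqP -> := us; have /card_uniqP -> := usrc.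
  by rewrite !size_map.
- apply/setP => w; rewrite [RHS]inE; apply/negP.
  rewrite in_setI inE => /andP[/mapP[t t_in ->] nt].
  have e := near _ t_in (hreach_near nt (top_conn _ t_in)).
  have : trek_src t \in Y :&: (v |: sib B v) by rewrite inE srcY // e.
  by rewrite dY inE.
exists (map crop_left ts); split; last by move=> t /mapP[t' _ ->].
split.
- by rewrite all_map; apply/allP => t /(allP all_t)/and3P[_ h1 h2]; apply/and3P.
- have e : [seq trek_src i | i <- [seq crop_left i | i <- ts]] = [seq t.1.1 | t <- ts].
    by rewrite -map_comp.
  by rewrite e.
- have e : [seq trek_tgt i | i <- [seq crop_left i | i <- ts]] = map (@trek_tgt m) ts.
    by rewrite -map_comp.
  by rewrite e.
- rewrite pairwise_map; apply: sub_pairwise dl => t1 t2 /= /pred0P h.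
  apply/pred0P => x /=; rewrite !inE; apply/negP => /andP[/eqP -> h2].
  by move: (h t1.1.1) h2; rewrite /= !inE eqxx /= => /negbT; case: (_ == _).
- by rewrite pairwise_map; apply: sub_pairwise dr.
Qed.

Lemma weak_HTC_identifiableE : weak_HTC_identifiable D B <-> HTC_identifiable D B.
Proof.
split=> -[Y [prec [ord hY hprec]]]; last first.
  by exists Y, prec; split=> // v; apply: HTC_weak.
have /fin_all_exists[Y' hY'] := fun v => weak_HTC_crop (hY v).
exists Y', prec; split=> // [v|v w wY vw]; first by case: (hY' v).
by apply: hprec => //; case: (hY' v) => _; apply.
Qed.

Lemma weak_HTC_infinite_to_oneE :
  weak_HTC_infinite_to_one D B <-> HTC_infinite_to_one D B.
Proof.
split=> h Y.
  case: (h Y) => [[v nv]|]; last by right.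
  by left; exists v => /HTC_weak.
case: (classic (exists v, ~ weak_HTC D B v (Y v))); first by left.
move=> hv; right.
have {hv} hY v : weak_HTC D B v (Y v) by apply: NNPP => n; apply: hv; exists v.
have /fin_all_exists[Y' hY'] := fun v => weak_HTC_crop (hY v).
case: (h Y') => [[v nv]|]; first by case: (hY' v).
(* By [HTC_htr] each of the two nodes is in the [htr] of the other, where membership in [Y'] implies
   membership in [Y]. *)
move=> [v [w [nvw vw wv]]]; exists v, w; split=> //.
  case: (hY' w) => _; apply=> //; apply: HTC_htr wv.
  by case: (hY' v).
case: (hY' v) => _; apply=> //; apply: HTC_htr vw.
by case: (hY' w).
Qed.

End HalfTreks.

(** * Half-trek systems and minors of the half-trek matrix *)

Section Injectivity.

Variables (F : fieldType).

Lemma det_neq0_perm n (A : 'M[F]_n) :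
  \det A != 0 -> exists s : {perm 'I_n}, forall i, A i (s i) != 0.
Proof.
move=> dA; apply: NNPP => ns; move/eqP: dA; apply; rewrite /determinant big1 // => s _.
have [i /eqP Ai0] : exists i, A i (s i) == 0.
  apply: NNPP => h; apply: ns; exists s => i; apply/negP => Ai.
  by apply: h; exists i.
by rewrite (bigD1 i) //= Ai0 mul0r mulr0.
Qed.

Lemma det_injP n (A : 'M[F]_n) :
  (forall x : 'cV_n, A *m x = 0 -> x = 0) <-> \det A != 0.
Proof.
split=> [h|dA x Ax0]; last first.
  have uA : A \in unitmx by rewrite unitmxE unitfE.
  by rewrite -[x](mulKmx uA) Ax0 mulmx0.
rewrite -det_tr; apply/det0P => -[v nv vA]; case/eqP: nv.
by apply: trmx_inj; rewrite trmx0; apply: h; rewrite -[A]trmxK -trmx_mul vA trmx0.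
Qed.

End Injectivity.

Section HalfTrekMatrix.

Variables (R : rcfType) (m : nat) (D B : rel 'I_m).
Implicit Types (L O : 'M[R]_m) (Y P : {set 'I_m}).

(** Without positive definiteness the parameter space is a linear space minus the zeros of one
    determinant, so genericity can be tested along lines; [dense_Theta] leads back to [in_Theta]. *)
Definition in_preTheta L O : Prop :=
  [/\ in_RDreg D L, O^T = O & forall v w, v != w -> ~~ B v w -> O v w = 0].

Definition htmx L O : 'M[R]_m := O *m invmx (1%:M - L).

(** Vectors of full length supported on [P] avoid reindexing a submatrix. For [#|Y| = #|P|] this
    says that the minor with rows [Y] and columns [P] is nonzero. *)
Definition inj_on (A : 'M[R]_m) Y P : Prop :=
  forall z : 'cV_m, (forall u, u \notin P -> z u ord0 = 0) ->
    (forall y, y \in Y -> (A *m z) y ord0 = 0) -> z = 0.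

(* The rows outside [P] of [1 - L], completed by the rows [Y] of [O], form an
   invertible matrix; a nonzero term of its determinant is a permutation whose
   orbits, cut at their visits to [P], are the right sides of the treks. *)
Lemma htsystem_of_inj L O Y P : in_preTheta L O -> #|Y| = #|P| ->
  inj_on (htmx L O) Y P ->
  exists ts, trek_system_nsi D B Y P ts /\ forall t, t \in ts -> is_halftrek t.
Proof.
move=> [[DL uL] _ BO] cYP injH.
case: (posnP #|P|) => [P0|Pgt0].
  have Pe : P = set0 by apply/eqP; rewrite -cards_eq0 P0.
  have Ye : Y = set0 by apply/eqP; rewrite -cards_eq0 cYP P0.
  exists [::]; split=> //; split=> //; split=> //; rewrite ?Pe ?Ye;
    by apply/setP => x; rewrite !inE.
have [p0 p0P] : exists p, p \in P by apply/card_gt0P.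
pose beta a := nth p0 (enum Y) (index a (enum P)).
have sEY : size (enum Y) = #|Y| by rewrite -cardE.
have sEP : size (enum P) = #|P| by rewrite -cardE.
have betaY a : a \in P -> beta a \in Y.
  move=> aP; rewrite -mem_enum mem_nth // sEY cYP -sEP index_mem.
  by rewrite mem_enum.
have beta_inj : {in P &, injective beta}.
  move=> a b aP bP /eqP; rewrite nth_uniq ?enum_uniq //; last first.
  - by rewrite sEY cYP -sEP index_mem mem_enum.
  - by rewrite sEY cYP -sEP index_mem mem_enum.
  move/eqP => e; rewrite -(nth_index p0 (s := enum P) (x := a)) ?mem_enum // e.
  by rewrite nth_index ?mem_enum.
have beta_im : [set beta a | a in P] = Y.
  apply/eqP; rewrite eqEcard card_in_imset // cYP leqnn andbT.
  by apply/subsetP => _ /imsetP[a aP ->]; apply: betaY.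
pose N := \matrix_(a, b) (if a \in P then O (beta a) b else (1%:M - L) a b).
have /det_neq0_perm[s hs] : \det N != 0.
  apply/det_injP => x Nx.
  have nP a : a \notin P -> ((1%:M - L) *m x) a ord0 = 0.
    move=> aP; move/matrixP/(_ a ord0): Nx; rewrite !mxE => {2}<-.
    by apply: eq_bigr => b _; rewrite [N _ _]mxE (negbTE aP).
  have nY y : y \in Y -> (htmx L O *m ((1%:M - L) *m x)) y ord0 = 0.
    rewrite -beta_im => /imsetP[a aP ->].
    rewrite /htmx -!mulmxA mulKmx //.
    move/matrixP/(_ a ord0): Nx; rewrite !mxE => {2}<-.
    by apply: eq_bigr => b _; rewrite [N _ _]mxE aP.
  have /(congr1 (mulmx (invmx (1%:M - L)))) := injH _ nP nY.
  by rewrite mulKmx // mulmx0.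
have sP a : a \in P -> (beta a == s a) || B (beta a) (s a).
  move=> aP; move: (hs a); rewrite mxE aP; case: (eqVneq (beta a) (s a)) => //= nba.
  by apply: contraNT => nB; apply/eqP; apply: BO.
have sD a : a \notin P -> a != s a -> D a (s a).
  move=> aP nsa; move: (hs a); rewrite mxE (negbTE aP) !mxE (negbTE nsa) sub0r oppr_eq0.
  by apply: contraNT => nD; apply/eqP; apply: DL.
(* The orbit length is a positive return time, so each [p] in [P] has a first return time [n p]; the
   implication lets [n] be defined for every [p]. *)
have ret p : exists n, (p \in P) ==> (0 < n)%N && (iter n s p \in P).
  exists (fingraph.order s p); apply/implyP => pP.
  by rewrite fingraph.order_gt0 fingraph.iter_order //; apply: perm_inj.
pose n p := ex_minn (ret p).
have nP p : p \in P -> (0 < n p)%N /\ iter (n p) s p \in P.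
  by move=> pP; rewrite /n; case: ex_minnP => k; rewrite pP => /andP[].
have n_min p j : p \in P -> (0 < j < n p)%N -> iter j s p \notin P.
  move=> pP; rewrite /n; case: ex_minnP => k _ kmin /andP[j0 jk].
  apply: contraL jk => jP; rewrite -leqNgt; apply: kmin.
  by rewrite j0 jP implybT.
have iter_fix j p : iter j.+1 s p = iter j s p -> s p = p.
  by elim: j => // j IH /= /perm_inj.
have iter_inj k : injective (iter k s) by elim: k => //= k IH a b /perm_inj/IH.
(* If two segments meet at steps [i <= j], cancelling [i] steps writes [p] as the iterate [j - i] of
   [q]. If positive, this is a return of [q] to [P] before time [n q]. *)
have iter_meet p q i j : p \in P -> q \in P -> (0 < i <= n p)%N -> (0 < j <= n q)%N ->
    iter i s p = iter j s q -> p = q.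
  wlog: p q i j / (i <= j)%N.
    move=> hw pP qP hi hj e; case/orP: (leq_total i j) => h; first exact: (hw p q i j).
    by apply/esym/(hw q p j i).
  move=> ij pP qP /andP[i0 ip] /andP[j0 jq].
  rewrite -(subnKC ij) iterD => /iter_inj e.
  case: (posnP (j - i)%N) => [d0|d_gt0]; first by move: e; rewrite d0.
  have : iter (j - i) s q \notin P.
    apply: n_min => //; rewrite d_gt0 /=; apply: leq_trans jq.
    by rewrite ltn_subrL i0.
  by rewrite -e pP.
(* The right side runs from [s p] to the first return [iter (n p) s p], which has [n p] nodes in
   all. That target may differ from [p]; only the set of targets is [P]. *)
pose tk p : trek m := ((beta p, [::]), (s p, traject s (s (s p)) (n p).-1)).
have tkR p : p \in P -> trek_right (tk p) = traject s (s p) (n p).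
  by move=> /nP[n0 _]; rewrite /trek_right /= -trajectS prednK.
have tkT p : p \in P -> trek_tgt (tk p) = iter (n p) s p.
  move=> /nP[n0 _]; rewrite /trek_tgt /= last_traject.
  by rewrite -iterSr prednK.
have tkP p : p \in P -> is_trek D B (tk p).
  move=> pP; have [n0 _] := nP _ pP; rewrite /is_trek /= sP // andbT.
  apply/(pathP p) => i; rewrite size_traject => ilt.
  have lt1 : (0 < i.+1 < n p)%N by rewrite /= -[n p]prednK.
  have ntj y k : (i < k)%N -> nth p (traject s y k) i = iter i s y.
    by move=> h; rewrite (set_nth_default y) ?size_traject // nth_traject.
  rewrite -trajectS !ntj // ?ltnS; last exact: ltnW.
  rewrite -!iterSr; have aP := n_min _ _ pP lt1.
  (* A fixed point of [s] on the segment would propagate back to [p], making this inner node equal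
     to [p], which lies in [P]. *)
  rewrite [iter i.+2 _ _]iterS; apply: sD => //; apply/eqP => /esym e.
  have sp := iter_fix i.+1 p e.
  have : forall k, iter k s p = p by elim=> //= k ->.
  by move=> /(_ i.+1) e1; rewrite e1 pP in aP.
have uE : uniq (enum P) by apply: enum_uniq.
exists (map tk (enum P)); split; last by move=> t /mapP[p _ ->].
split.
- by apply/allP => t /mapP[p]; rewrite mem_enum => pP ->; apply: tkP.
- rewrite -map_comp; split.
    by rewrite map_inj_in_uniq // => a b; rewrite !mem_enum => aP bP; apply: beta_inj.
  rewrite -beta_im; apply/setP => y; rewrite inE.
  apply/mapP/imsetP => -[p pP ->]; exists p => //; move: pP;
    by rewrite mem_enum.
- have ut : uniq [seq trek_tgt i | i <- [seq tk i | i <- enum P]].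
    rewrite -map_comp map_inj_in_uniq // => a b; rewrite !mem_enum => aP bP /=.
    rewrite !tkT // => e.
    by apply: (iter_meet _ _ _ _ aP bP _ _ e); rewrite leqnn andbT; case: (nP a aP); case: (nP b bP).
  split=> //; apply/eqP; rewrite eqEcard; apply/andP; split.
    apply/subsetP => x; rewrite inE -map_comp => /mapP[p]; rewrite mem_enum => pP ->.
    by rewrite /= tkT //; case: (nP p pP).
  by rewrite cardsE; have /card_uniqP -> := ut; rewrite !size_map sEP.
- have allP_P : all (mem P) (enum P) by apply/allP => p; rewrite mem_enum.
  rewrite pairwise_map; move: uE; rewrite uniq_pairwise.
  apply: (sub_in_pairwise _ allP_P) => p q pP qP npq.
  apply/pred0P => x /=; rewrite !inE; apply/negP => /andP[/eqP -> /eqP e].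
  by case/eqP: npq; apply: beta_inj.
have allP_P : all (mem P) (enum P) by apply/allP => p; rewrite mem_enum.
rewrite pairwise_map; move: uE; rewrite uniq_pairwise.
apply: (sub_in_pairwise _ allP_P) => p q pP qP npq.
apply/pred0P => x /=; rewrite !tkR //; apply/negP => /andP[/trajectP[i ip ->]] /trajectP[j jq].
rewrite -!iterSr => e; case/eqP: npq.
by apply: (iter_meet _ _ _ _ pP qP _ _ e).
Qed.

End HalfTrekMatrix.

(** * Polynomial functions and density *)

Section RingClosed.

Variable R : comNzRingType.

(** Polynomial, univariate, regular and rational functions share this interface, so determinants,
    adjugates and matrix products are treated once for all. The last clause stands in for functional
    extensionality. *)
Definition ring_closed (E : Type) (K : (E -> R) -> Prop) : Prop :=
  [/\ forall c, K (fun=> c),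
      forall f g, K f -> K g -> K (fun x => f x + g x),
      forall f g, K f -> K g -> K (fun x => f x * g x)
    & forall f g, f =1 g -> K f -> K g].

Variables (E : Type) (K : (E -> R) -> Prop).
Hypothesis cK : ring_closed K.

Lemma rc_const c : K (fun=> c). Proof. by case: cK. Qed.
Lemma rc_add f g : K f -> K g -> K (fun x => f x + g x). Proof. by case: cK => _ h _ _; apply: h. Qed.
Lemma rc_mul f g : K f -> K g -> K (fun x => f x * g x). Proof. by case: cK => _ _ h _; apply: h. Qed.
Lemma rc_ext f g : f =1 g -> K f -> K g. Proof. by case: cK => _ _ _; apply. Qed.

Lemma rc_opp f : K f -> K (fun x => - f x).
Proof.
by move=> kf; apply: (rc_ext _ (rc_mul (rc_const (-1)) kf)) => x; rewrite mulN1r.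
Qed.

Lemma rc_sub f g : K f -> K g -> K (fun x => f x - g x).
Proof. by move=> kf kg; apply: rc_add => //; apply: rc_opp. Qed.

Lemma rc_sum (I : Type) (r : seq I) (P : pred I) (f : I -> E -> R) :
  (forall i, K (f i)) -> K (fun x => \sum_(i <- r | P i) f i x).
Proof.
move=> kf; elim: r => [|i r IH].
  by apply: (rc_ext _ (rc_const 0)) => x; rewrite big_nil.
apply: (rc_ext (f := fun x => (if P i then f i x else 0) + \sum_(j <- r | P j) f j x)).
  by move=> x; rewrite big_cons; case: (P i); rewrite ?add0r.
by apply: rc_add => //; case: (P i) => //; apply: rc_const.
Qed.

Lemma rc_prod (I : Type) (r : seq I) (P : pred I) (f : I -> E -> R) :
  (forall i, K (f i)) -> K (fun x => \prod_(i <- r | P i) f i x).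
Proof.
move=> kf; elim: r => [|i r IH].
  by apply: (rc_ext _ (rc_const 1)) => x; rewrite big_nil.
apply: (rc_ext (f := fun x => (if P i then f i x else 1) * \prod_(j <- r | P j) f j x)).
  by move=> x; rewrite big_cons; case: (P i); rewrite ?mul1r.
by apply: rc_mul => //; case: (P i) => //; apply: rc_const.
Qed.

Lemma rc_exp f n : K f -> K (fun x => f x ^+ n).
Proof.
move=> kf; elim: n => [|n IH].
  by apply: (rc_ext _ (rc_const 1)) => x; rewrite expr0.
by apply: (rc_ext _ (rc_mul kf IH)) => x; rewrite exprS.
Qed.

Definition mx_in m n (A : E -> 'M[R]_(m, n)) : Prop := forall i j, K (fun x => A x i j).

Lemma rc_det n (A : E -> 'M[R]_n) : mx_in A -> K (fun x => \det (A x)).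
Proof.
move=> kA; apply: rc_sum => s; apply: rc_mul; first exact: rc_const.
exact: rc_prod.
Qed.

Lemma rc_mulmx m n p (A : E -> 'M[R]_(m, n)) (C : E -> 'M[R]_(n, p)) :
  mx_in A -> mx_in C -> mx_in (fun x => A x *m C x).
Proof.
move=> kA kC i j.
apply: (rc_ext (f := fun x => \sum_k A x i k * C x k j)); first by move=> x; rewrite mxE.
by apply: rc_sum => k; apply: rc_mul.
Qed.

Lemma rc_addmx m n (A C : E -> 'M[R]_(m, n)) :
  mx_in A -> mx_in C -> mx_in (fun x => A x + C x).
Proof.
move=> kA kC i j; apply: (rc_ext _ (rc_add (kA i j) (kC i j))) => x; by rewrite mxE.
Qed.

Lemma rc_submx m n (A C : E -> 'M[R]_(m, n)) :
  mx_in A -> mx_in C -> mx_in (fun x => A x - C x).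
Proof.
move=> kA kC i j; apply: (rc_ext _ (rc_sub (kA i j) (kC i j))) => x; by rewrite !mxE.
Qed.

Lemma rc_trmx m n (A : E -> 'M[R]_(m, n)) : mx_in A -> mx_in (fun x => (A x)^T).
Proof. by move=> kA i j; apply: (rc_ext _ (kA j i)) => x; rewrite mxE. Qed.

Lemma rc_cstmx m n (A : 'M[R]_(m, n)) : mx_in (fun=> A).
Proof. by move=> i j; apply: rc_const. Qed.

Lemma rc_adj n (A : E -> 'M[R]_n) : mx_in A -> mx_in (fun x => \adj (A x)).
Proof.
move=> kA i j.
apply: (rc_ext (f := fun x => (-1) ^+ (j + i) * \det (row' j (col' i (A x))))).
  by move=> x; rewrite mxE.
apply: rc_mul; first exact: rc_const.
apply: rc_det => a b.
by apply: (rc_ext _ (kA (lift j a) (lift i b))) => x; rewrite !mxE.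
Qed.

Lemma rc_meval (X : Type) (c : E -> X -> R) (p : mpoly R X) :
  (forall i, K (c^~ i)) -> K (fun x => meval (c x) p).
Proof.
move=> kc; elim: p => /= [a|i|p IHp q IHq|p IHp q IHq] //.
- exact: rc_const.
- exact: rc_add.
- exact: rc_mul.
Qed.

End RingClosed.

Section PolyFunctions.

Variable R : rcfType.

Definition polyfn (E X : Type) (c : E -> X -> R) (h : E -> R) : Prop :=
  exists p : mpoly R X, forall x, meval (c x) p = h x.

Lemma polyfn_closed (E X : Type) (c : E -> X -> R) : ring_closed (polyfn c).
Proof.
split=> [a|f g [p hp] [q hq]|f g [p hp] [q hq]|f g e [p hp]].
- by exists (MPconst _ a).
- by exists (MPadd p q) => x /=; rewrite hp hq.
- by exists (MPmul p q) => x /=; rewrite hp hq.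
- by exists p => x; rewrite hp e.
Qed.

Lemma polyfn_var (E X : Type) (c : E -> X -> R) i : polyfn c (c^~ i).
Proof. by exists (MPvar _ i). Qed.

Definition unifn (h : R -> R) : Prop := exists p : {poly R}, forall s, p.[s] = h s.

Lemma unifn_closed : ring_closed unifn.
Proof.
split=> [a|f g [p hp] [q hq]|f g [p hp] [q hq]|f g e [p hp]].
- by exists a%:P => s; rewrite hornerC.
- by exists (p + q) => s; rewrite hornerD hp hq.
- by exists (p * q) => s; rewrite hornerM hp hq.
- by exists p => s; rewrite hp e.
Qed.

Lemma unifn_id : unifn id. Proof. by exists 'X => s; rewrite hornerX. Qed.

Lemma unifn_affine a b : unifn (fun s => a + s * b).
Proof.
apply: (rc_add unifn_closed); first exact: (rc_const unifn_closed _).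
apply: (rc_mul unifn_closed); [exact: unifn_id | exact: (rc_const unifn_closed _)].
Qed.

(** The [size p] distinct points [a + (b - a) / (i + 2)] lie strictly between [a] and [b], and [p]
    has fewer roots than that. *)
Lemma nonroot_itv (p : {poly R}) a b : p != 0 -> a < b ->
  exists s, [/\ a < s, s < b & p.[s] != 0].
Proof.
move=> p0 ab; pose f (i : nat) : R := a + (b - a) / i.+2%:R.
have ba : 0 < b - a by rewrite subr_gt0.
have f_inj : injective f.
  move=> i j /addrI /(mulfI (lt0r_neq0 ba)) /invr_inj /eqP.
  by rewrite eqr_nat => /eqP [].
pose rs := [seq f i | i <- iota 0 (size p)].
have urs : uniq rs by rewrite map_inj_uniq // iota_uniq.
have [all_r|/allPn[s /mapP[i _ ->] ns]] := boolP (all (root p) rs).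
  by have := max_poly_roots p0 all_r urs; rewrite size_map size_iota ltnn.
exists (f i); split=> //.
  by rewrite ltrDl divr_gt0.
rewrite -ltrBrDl ltr_pdivrMr // ltr_pMr //.
by rewrite (ltr_nat _ 1).
Qed.

Lemma unifn_nonroot h a b s0 : unifn h -> h s0 != 0 -> a < b ->
  exists s, [/\ a < s, s < b & h s != 0].
Proof.
move=> [p hp] h0 ab; have p0 : p != 0.
  by apply: contraNneq h0 => p0; rewrite -hp p0 horner0.
by have [s [h1 h2 h3]] := nonroot_itv p0 ab; exists s; rewrite -hp.
Qed.

End PolyFunctions.

(** * Regular functions and irreducibility of the parameter space *)

Section Density.

Variables (R : rcfType) (m : nat) (D B : rel 'I_m).
Notation point := ('M[R]_m * 'M[R]_m)%type.
Implicit Types (x y : point) (L O : 'M[R]_m).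

Definition pcoord x : param_var m -> R := param_coord x.1 x.2.
Definition preTheta x : Prop := in_preTheta D B x.1 x.2.
Definition detL x : R := \det (1%:M - x.1).

(** Polynomials localized at [detL], with the denominator cleared and the identity imposed on
    [preTheta] only. *)
Definition regfn (h : point -> R) : Prop :=
  exists (N : nat) (p : point -> R), polyfn pcoord p /\
    forall x, preTheta x -> detL x ^+ N * h x = p x.

Lemma pfn_L i j : polyfn pcoord (fun x => x.1 i j).
Proof. exact: (polyfn_var pcoord (inl (i, j))). Qed.

Lemma pfn_O i j : polyfn pcoord (fun x => x.2 i j).
Proof. exact: (polyfn_var pcoord (inr (i, j))). Qed.

Let pc := polyfn_closed pcoord.

Lemma pfn_IL : mx_in (polyfn pcoord) (fun x => 1%:M - x.1).
Proof. apply: (rc_submx pc); [exact: (rc_cstmx pc _) | exact: pfn_L]. Qed.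

Lemma pfn_detL : polyfn pcoord detL.
Proof. exact: (rc_det pc pfn_IL). Qed.

Lemma regfn_closed : ring_closed regfn.
Proof.
split=> [a|f g [N [p [kp hp]]] [M [q [kq hq]]]|f g [N [p [kp hp]]] [M [q [kq hq]]]
  |f g e [N [p [kp hp]]]].
- by exists 0%N, (fun=> a); split=> [|x _]; [apply: (rc_const pc _) | rewrite expr0 mul1r].
- exists (N + M)%N, (fun x => detL x ^+ M * p x + detL x ^+ N * q x); split.
    by apply: (rc_add pc); apply: (rc_mul pc) => //; apply: (rc_exp pc) => //; apply: pfn_detL.
  by move=> x tx; rewrite -hp // -hq // exprD; ring.
- exists (N + M)%N, (fun x => p x * q x); split; first exact: (rc_mul pc).
  by move=> x tx; rewrite -hp // -hq // exprD; ring.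
- by exists N, p; split=> // x tx; rewrite -e hp.
Qed.

Lemma regfn_poly h : polyfn pcoord h -> regfn h.
Proof. by exists 0%N, h; split=> // x _; rewrite expr0 mul1r. Qed.

Lemma detL_neq0 x : preTheta x -> detL x != 0.
Proof. by case=> [[_]]; rewrite unitmxE unitfE. Qed.

Lemma regfn_invmx : mx_in regfn (fun x => invmx (1%:M - x.1)).
Proof.
move=> i j; exists 1%N, (fun x => (\adj (1%:M - x.1)) i j); split.
  exact: (rc_adj pc pfn_IL).
move=> x tx; have dx := detL_neq0 tx.
case: tx => [[_ uL] _ _]; rewrite expr1 /invmx uL mxE mulrA divff ?mul1r //.
Qed.

Lemma regfn_L : mx_in regfn (fun x => x.1).
Proof. by move=> i j; apply: regfn_poly; apply: pfn_L. Qed.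

Lemma regfn_O : mx_in regfn (fun x => x.2).
Proof. by move=> i j; apply: regfn_poly; apply: pfn_O. Qed.

Lemma regfn_htmx : mx_in regfn (fun x => htmx x.1 x.2).
Proof. exact: (rc_mulmx regfn_closed regfn_O regfn_invmx). Qed.

Lemma regfn_phi : mx_in regfn (fun x => phiG x.1 x.2).
Proof.
apply: (rc_mulmx regfn_closed _ regfn_invmx).
exact: (rc_mulmx regfn_closed (rc_trmx regfn_closed regfn_invmx) regfn_O).
Qed.

Definition line x y (s : R) : point := (x.1 + s *: (y.1 - x.1), x.2 + s *: (y.2 - x.2)).

Lemma unifn_line x y p : polyfn pcoord p -> unifn (fun s => p (line x y s)).
Proof.
move=> [q hq].
apply: (rc_ext (@unifn_closed R) (f := fun s => meval (pcoord (line x y s)) q)) => //.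
apply: (rc_meval (@unifn_closed R)) => -[[i j]|[i j]];
  apply: (rc_ext (@unifn_closed R) _ (unifn_affine _ _)) => s /=; rewrite !mxE; reflexivity.
Qed.

Lemma line0 x y : line x y 0 = x.
Proof. by rewrite /line !scale0r !addr0 -surjective_pairing. Qed.

Lemma line1 x y : line x y 1 = y.
Proof. by rewrite /line !scale1r !subrKC -surjective_pairing. Qed.

Lemma preTheta_line x y s : preTheta x -> preTheta y -> detL (line x y s) != 0 ->
  preTheta (line x y s).
Proof.
move=> [[DL uL] sO BO] [[DL' uL'] sO' BO'] dl; split; first split.
- by move=> v w nD; rewrite /= !mxE DL // DL' // subrr mulr0 addr0.
- by rewrite unitmxE unitfE.
- by rewrite /= linearD linearZ /= linearB /= sO sO'.
- by move=> v w nvw nB; rewrite /= !mxE BO // BO' // subrr mulr0 addr0.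
Qed.

Lemma regfn_line h x y : regfn h -> exists2 p, unifn p &
  forall s, preTheta (line x y s) -> (p s != 0) = (h (line x y s) != 0).
Proof.
move=> [N [p [kp hp]]]; exists (fun s => p (line x y s)); first exact: unifn_line.
move=> s ts; rewrite -hp // mulf_eq0 negb_or expf_neq0 //.
exact: detL_neq0.
Qed.

(** On the line joining the two witnesses, the numerators of [f] and [g] restrict to nonzero
    polynomials in one variable, and so does [detL], which controls membership in [preTheta]. A
    common nonroot gives the point. *)
Lemma dense_mul f g : regfn f -> regfn g ->
  (exists2 x, preTheta x & f x != 0) -> (exists2 x, preTheta x & g x != 0) ->
  exists2 x, preTheta x & f x * g x != 0.
Proof.
move=> kf kg [x tx fx] [y ty gy].
have [p kp hp] := regfn_line x y kf.
have [q kq hq] := regfn_line x y kg.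
have kd := unifn_line x y pfn_detL.
have p0 : p 0 != 0 by rewrite hp line0.
have q0 : q 1 != 0 by rewrite hq line1.
have d0 : detL (line x y 0) != 0 by rewrite line0 detL_neq0.
case: kp hp p0 => pp hpp hp p0; case: kq hq q0 => pq hpq hq q0.
case: kd d0 => pd hpd d0.
have nz (r : {poly R}) s : r.[s] != 0 -> r != 0.
  by apply: contraNneq => ->; rewrite horner0.
have npp : pp != 0 by apply: (nz _ 0); rewrite hpp.
have npq : pq != 0 by apply: (nz _ 1); rewrite hpq.
have npd : pd != 0 by apply: (nz _ 0); rewrite hpd.
have := mulf_neq0 npd (mulf_neq0 npp npq).
move=> /nonroot_itv /(_ (@ltr01 R)) [s [_ _]].
rewrite !hornerM !mulf_eq0 !negb_or hpp hpq hpd => /and3P[h1 h2 h3].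
have tl := preTheta_line tx ty h1.
by exists (line x y s); rewrite // mulf_neq0 // -?hp // -hq.
Qed.

Lemma dense_prod (I : eqType) (r : seq I) (f : I -> point -> R) :
  (forall i, i \in r -> regfn (f i)) ->
  (forall i, i \in r -> exists2 x, preTheta x & f i x != 0) ->
  (exists x, preTheta x) ->
  exists2 x, preTheta x & forall i, i \in r -> f i x != 0.
Proof.
move=> kf hf [x0 t0].
suff [g [kg [x tx gx] hg]] : exists g, [/\ regfn g, exists2 x, preTheta x & g x != 0
    & forall x, g x != 0 -> forall i, i \in r -> f i x != 0].
  by exists x => //; apply: hg.
elim: r kf hf => [|i r IH] kf hf.
  exists (fun=> 1); split=> //; first exact: (rc_const regfn_closed _).
  by exists x0; rewrite ?oner_neq0.
have [j jr|j jr|g [kg hg hgr]] := IH.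
- by apply: kf; rewrite inE jr orbT.
- by apply: hf; rewrite inE jr orbT.
exists (fun x => f i x * g x); split.
- by apply: (rc_mul regfn_closed) => //; apply: kf; rewrite mem_head.
- by apply: dense_mul => //; [apply: kf; rewrite mem_head | apply: hf; rewrite mem_head].
move=> x; rewrite mulf_eq0 negb_or => /andP[h1 h2] j; rewrite inE => /orP[/eqP ->|] //.
exact: hgr.
Qed.

Lemma preTheta1 : preTheta (0, 1%:M).
Proof.
split; first split=> [v w _|]; rewrite ?mxE ?subr0 ?unitmx1 ?trmx1 //.
by move=> v w nvw _; rewrite mxE (negbTE nvw).
Qed.

Lemma Theta_preTheta L O : in_Theta D B L O -> preTheta (L, O).
Proof. by move=> [h1 [h2 h3 _]]; split. Qed.

Lemma quadE (A : 'M[R]_m) (x : 'cV_m) :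
  (x^T *m A *m x) ord0 ord0 = \sum_i \sum_j x i ord0 * A i j * x j ord0.
Proof.
rewrite mxE exchange_big /=; apply: eq_bigr => j _; rewrite mxE mulr_suml.
by apply: eq_bigr => i _; rewrite mxE.
Qed.

(** Here [c - 1] is the sum of the absolute values of the entries of [X], so the form of [X] is at
    least [- (c - 1)] times the squared norm. *)
Lemma near1_pd (X : 'M[R]_m) : exists2 e, 0 < e &
  forall s, 0 < s -> s < e -> forall x : 'cV[R]_m, x != 0 ->
    0 < (x^T *m (1%:M + s *: X) *m x) ord0 ord0.
Proof.
pose c := 1 + \sum_i \sum_j `|X i j|.
have c0 : 0 < c.
  by rewrite ltr_pwDl // sumr_ge0 // => i _; rewrite sumr_ge0.
exists c^-1; first by rewrite invr_gt0.
move=> s s0 sc x nx.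
pose n := \sum_i x i ord0 ^+ 2.
have xn i : x i ord0 ^+ 2 <= n.
  by rewrite /n (bigD1 i) //= lerDl sumr_ge0 // => j _; rewrite sqr_ge0.
have n0 : 0 < n.
  have [i xi] : exists i, x i ord0 != 0.
    apply: NNPP => h; case/eqP: nx; apply/colP => i; rewrite mxE.
    by apply/eqP/negPn/negP => xi; apply: h; exists i.
  by apply: lt_le_trans (xn i); rewrite exprn_even_gt0.
have e1 : (x^T *m (1%:M + s *: X) *m x) ord0 ord0
    = n + s * (x^T *m X *m x) ord0 ord0.
  rewrite mulmxDr mulmxDl mulmx1 -scalemxAr -scalemxAl !mxE; congr (_ + _).
  by apply: eq_bigr => i _; rewrite mxE expr2.
have e2 : - ((c - 1) * n) <= (x^T *m X *m x) ord0 ord0.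
  rewrite quadE /c addrC addKr mulr_suml -sumrN; apply: ler_sum => i _.
  rewrite mulr_suml -sumrN; apply: ler_sum => j _.
  rewrite lerNl; apply: (le_trans (ler_norm _)).
  rewrite normrN !normrM mulrAC mulrC ler_wpM2l //.
  rewrite -normrM ler_norml.
  move: (xn i) (xn j); set a := x i ord0; set b := x j ord0.
  have h1 := sqr_ge0 (a - b); have h2 := sqr_ge0 (a + b).
  by move=> h3 h4; apply/andP; split; nra.
rewrite e1.
have sc1 : s * c < 1 by rewrite -ltr_pdivlMr // mul1r.
nra.
Qed.

(** Moving [O] to the identity with [L] fixed leaves [detL] unchanged. Near the identity the
    matrices are positive definite, and the numerator of [h], a nonzero polynomial along the line,
    has a nonroot there. *)
Lemma dense_Theta h : regfn h -> (exists2 x, preTheta x & h x != 0) ->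
  exists L O, in_Theta D B L O /\ h (L, O) != 0.
Proof.
move=> kh [[L O] tx hx].
have [p kp hp] := regfn_line (L, 1%:M) (L, O) kh.
have [e e0 he] := near1_pd (O - 1%:M).
have t1 : preTheta (L, 1%:M) by case: tx => h1 _ _; case: preTheta1 => _ h2 h3; split.
have tl s : preTheta (line (L, 1%:M) (L, O) s).
  apply: preTheta_line => //; rewrite /detL /= subrr scaler0 addr0.
  exact: (detL_neq0 tx).
have p1 : p 1 != 0 by rewrite hp // line1.
have [s [s0 se ps]] := unifn_nonroot kp p1 e0.
exists L, (1%:M + s *: (O - 1%:M)); split; last first.
  by move: ps; rewrite hp // /line /= subrr scaler0 addr0.
case: (tl s) => _ h2 h3; case: tx => h1 _ _.
by split=> //; split=> //; apply: he.
Qed.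

End Density.

(** * Realizing half-trek systems by nonzero minors *)

Section Realization.

Variables (R : rcfType) (m : nat) (D B : rel 'I_m).
Hypothesis symB : symmetric B.

Lemma sqnorm_eq0 n (x : 'cV[R]_n) : ((x^T *m x) ord0 ord0 == 0) = (x == 0).
Proof.
apply/eqP/eqP => [|->]; last by rewrite mulmx0 mxE.
rewrite mxE => /eqP; rewrite psumr_eq0 => [/allP h|i _]; last by rewrite mxE -expr2 sqr_ge0.
apply/colP => i; have := h i (mem_index_enum _); rewrite !mxE mulf_eq0 orbb.
by move/eqP.
Qed.

Lemma sqnorm_ge0 n (x : 'cV[R]_n) : 0 <= (x^T *m x) ord0 ord0.
Proof. by rewrite mxE sumr_ge0 // => i _; rewrite mxE -expr2 sqr_ge0. Qed.

Lemma gram_ker n p q (A1 : 'M[R]_(p, n)) (A2 : 'M[R]_(q, n)) (x : 'cV_n) :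
  (A1^T *m A1 + A2^T *m A2) *m x = 0 -> A1 *m x = 0 /\ A2 *m x = 0.
Proof.
move=> /(congr1 (mulmx x^T)); rewrite mulmx0 mulmxDl mulmxDr !mulmxA.
rewrite -!trmx_mul -!mulmxA => /matrixP/(_ ord0 ord0); rewrite [LHS]mxE [RHS]mxE => /eqP.
rewrite paddr_eq0 ?sqnorm_ge0 // !sqnorm_eq0 => /andP[/eqP h1 /eqP h2].
by split.
Qed.

(** Induction on [k]. If some [y i] is not among the [r j], a symmetric perturbation at [y i], [r i]
    changes a single entry of the submatrix. The minor is then affine in [t] with a nonzero cofactor
    as slope, and [t = 0] or [t = 1] works. Otherwise [y] permutes the values of [r], and the
    identity matrix works. *)
Lemma sym_minor k (y r : 'I_k -> 'I_m) : injective y -> injective r ->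
  (forall i, (y i == r i) || B (y i) (r i)) ->
  exists O : 'M[R]_m, [/\ O^T = O, forall v w, v != w -> ~~ B v w -> O v w = 0
    & \det (\matrix_(i, j) O (y i) (r j)) != 0].
Proof.
elim: k y r => [|k IH] y r y_inj r_inj yr.
  exists 0; split; first by rewrite trmx0.
    by move=> v w _ _; rewrite mxE.
  by rewrite det_mx00 oner_neq0.
case: (pickP (fun i => [forall j, r j != y i])) => [i /forallP hi|hall].
  have nyr : y i != r i by rewrite eq_sym.
  have Byr : B (y i) (r i) by move: (yr i); rewrite (negbTE nyr).
  have [||l|O' [sO' BO' dO']] := IH (y \o lift i) (r \o lift i).
  - by apply: inj_comp => //; apply: lift_inj.
  - by apply: inj_comp => //; apply: lift_inj.
  - exact: yr.
  pose X := \matrix_(a, b) O' (y a) (r b).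
  have cX : cofactor X i i != 0.
    rewrite /cofactor mulf_neq0 ?signr_eq0 //.
    apply: contraNneq dO' => d0; apply/eqP; rewrite -[RHS]d0; congr (\det _).
    by apply/matrixP => a b; rewrite !mxE.
  pose E := delta_mx (y i) (r i) + delta_mx (r i) (y i) : 'M[R]_m.
  have sE : E^T = E by rewrite linearD /= !trmx_delta addrC.
  have BE v w : v != w -> ~~ B v w -> E v w = 0.
    move=> nvw nB; rewrite !mxE.
    case: (altP andP) => [[/eqP e1 /eqP e2]|_]; first by rewrite e1 e2 Byr in nB.
    case: (altP andP) => [[/eqP e1 /eqP e2]|_]; last by rewrite addr0.
    by rewrite e1 e2 symB Byr in nB.
  pose Ot t := O' + t *: E.
  have OtE t a b : Ot t (y a) (r b) = O' (y a) (r b) + t * ((a == i) && (b == i))%:R.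
    rewrite !mxE (negbTE (hi b)) andbF addr0.
    by rewrite (inj_eq y_inj) (inj_eq r_inj).
  have dt t : \det (\matrix_(a, b) Ot t (y a) (r b)) = \det X + t * cofactor X i i.
    rewrite (expand_det_row _ i) [\det X](expand_det_row _ i).
    have cE b : cofactor (\matrix_(a, b) Ot t (y a) (r b)) i b = cofactor X i b.
      congr (_ * \det _); apply/matrixP => a c; rewrite !mxE.
      by have := OtE t (lift i a) (lift b c); rewrite !mxE => ->; rewrite [lift i a == i]eq_sym (negbTE (neq_lift i a)) mulr0 addr0.
    have -> : t * cofactor X i i = \sum_b t * (b == i)%:R * cofactor X i b.
      rewrite (bigD1 i) //= eqxx mulr1 big1 ?addr0 // => b /negbTE ->.
      by rewrite mulr0 mul0r.
    rewrite -big_split; apply: eq_bigr => b _ /=.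
    by rewrite cE mxE OtE eqxx [X in _ = X * _ + _]mxE mulrDl.
  have st t : (Ot t)^T = Ot t by rewrite linearD linearZ /= sO' sE.
  have Bt t v w : v != w -> ~~ B v w -> Ot t v w = 0.
    by move=> nvw nB; rewrite mxE [X in _ + X]mxE BO' // BE // mulr0 addr0.
  have [d0|d0] := eqVneq (\det X) 0.
    by exists (Ot 1); split; [exact: st|exact: Bt|]; rewrite dt d0 add0r mul1r.
  by exists (Ot 0); split; [exact: st|exact: Bt|]; rewrite dt mul0r addr0.
exists 1%:M; split; first by rewrite trmx1.
  by move=> v w nvw _; rewrite mxE (negbTE nvw).
have {}hall i : exists j, r j = y i.
  move/negbT: (hall i); rewrite negb_forall => /existsP[j].
  by rewrite negbK => /eqP; exists j.
have /fin_all_exists[g hg] := hall.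
have g_inj : injective g by move=> i j e; apply: y_inj; rewrite -!hg e.
apply/det_injP => x Ax; apply/colP => j.
have [h _ gh] := injF_bij g_inj; rewrite -(gh j).
move/colP/(_ (h j)): Ax; rewrite !mxE => <-.
rewrite (bigD1 (g (h j))) //= !mxE hg eqxx mul1r big1 ?addr0 // => l nl.
rewrite !mxE -hg (inj_eq r_inj) eq_sym (negbTE nl) mul0r //.
Qed.

(* The paths of the system are made simple and get weight [1 / s], all other
   directed edges weight 0. After rescaling, the limit [s = 0] is nonsingular
   as soon as the submatrix of [O] from [Y] to the tops of the paths is. *)
Lemma inj_of_htsystem Y P ts : trek_system_nsi D B Y P ts ->
  (forall t, t \in ts -> is_halftrek t) ->
  exists2 x : 'M[R]_m * 'M[R]_m, preTheta D B x & inj_on (htmx x.1 x.2) Y P.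
Proof.
move=> [all_t [us eY] [ut eP] dl dr] hts.
pose k := size ts; pose T := in_tuple ts.
pose t (i : 'I_k) := tnth T i.
have tin i : t i \in ts by apply: mem_tnth.
pose y i := (t i).1.1; pose r i := (t i).2.1; pose S i := r i :: shorten (r i) (t i).2.2.
pose p i := trek_tgt (t i).
have tP i := allP all_t _ (tin i).
have yE i : y i = trek_src (t i) by rewrite halftrek_src ?hts.
have ut_ : uniq ts by apply: map_uniq us.
have t_inj : injective t by apply/(tuple_uniqP T).
have tsE a : a \in ts -> exists i, a = t i by move=> /(tnthP T)[i ->]; exists i.
have y_inj : injective y.
  have /tuple_uniqP s_inj : uniq (map_tuple (@trek_src m) T) by exact: us.
  by move=> i j; rewrite !yE => e; apply: s_inj; rewrite !tnth_map.
have SP i : [/\ path D (r i) (behead (S i)), uniq (S i), last (r i) (behead (S i)) = p i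
    & {subset S i <= trek_right (t i)}].
  case/and3P: (tP i) => _ pr _; rewrite /S /p /trek_tgt /=.
  case: (shortenP pr) => s ps us' ss; split=> //.
  by move=> a; rewrite !inE => /orP[->//|/ss ->]; rewrite orbT.
have Sdis i j a : a \in S i -> a \in S j -> i = j.
  case: (SP i) => _ _ _ si; case: (SP j) => _ _ _ sj /si ai /sj aj.
  apply: t_inj; apply/eqP; apply/negPn/negP => nij.
  move/(pairwiseP (t i)): dr => dr.
  have key (u v : 'I_k) : (u < v)%N -> a \in trek_right (t u) -> a \in trek_right (t v) -> False.
    move=> uv; have := dr u v (ltn_ord u) (ltn_ord v) uv.
    rewrite -!(tnth_nth _ T) => /pred0P/(_ a) /= + h1 h2.
    by rewrite h1 h2.
  case: (ltngtP i j) => h; [exact: key ai aj|exact: key aj ai|].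
  by move/val_inj: h nij => ->; rewrite eqxx.
have r_inj : injective r.
  by move=> i j e; apply: (Sdis _ _ (r i)); rewrite /S ?e mem_head.
have yr i : (y i == r i) || B (y i) (r i) by case/and3P: (tP i).
have [O [sO BO dO]] := sym_minor y_inj r_inj yr.
pose nx a b := [exists i, [&& a \in S i, b \in S i & index b (S i) == (index a (S i)).+1]].
pose U a := [exists i, a \in S i].
have nxU a b : nx a b -> U a by case/existsP => i /and3P[h _ _]; apply/existsP; exists i.
have nxD a b : nx a b -> D a b.
  case/existsP => i /and3P[ai bi /eqP ib].
  case: (SP i) => /(pathP (r i)) ps _ _ _.
  have bS : ((index a (S i)) < size (behead (S i)))%N.
    by rewrite size_behead -ltnS prednK // -ib index_mem.
  have := ps _ bS; rewrite [nth _ (r i :: _) _](nth_index _ ai).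
  by rewrite nth_behead -ib nth_index.
have nx_fun a b c : nx a b -> nx a c -> b = c.
  case/existsP => i /and3P[ai bi /eqP ib] /existsP[j /and3P[aj cj /eqP jc]].
  have e := Sdis _ _ _ ai aj; subst j.
  by rewrite -(nth_index a bi) ib -jc nth_index.
have pS i : p i \in S i by case: (SP i) => _ _ <- _; apply: mem_last.
have p_last i : index (p i) (S i) = (size (S i)).-1.
  by case: (SP i) => _ u <- _; exact: (index_last u).
have Pp a : a \in P -> exists i, a = p i.
  by rewrite -eP inE => /mapP[w /tsE[i ->] ->]; exists i.
have nx_P a b : nx a b -> a \notin P.
  move=> /existsP[i /and3P[ai bi /eqP ib]]; apply/negP => /Pp[j e]; subst a.
  have e := Sdis _ _ _ ai (pS j); subst j.
  by move: bi; rewrite -index_mem ib p_last prednK // ltnn.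
have has_pred b : U b -> (forall j, b != r j) -> exists a, nx a b.
  move=> /existsP[i bi] nr.
  have ib : (0 < index b (S i))%N by rewrite /= eq_sym (negbTE (nr i)).
  have lt : ((index b (S i)).-1 < size (S i))%N.
    by apply: leq_ltn_trans (leq_pred _) _; rewrite index_mem.
  exists (nth (r i) (S i) (index b (S i)).-1); apply/existsP; exists i.
  rewrite mem_nth // bi index_uniq ?prednK ?eqxx //.
    exact: index_size.
  by case: (SP i).
pose L0 : 'M[R]_m := \matrix_(a, b) (nx a b)%:R.
(* For [L = s^-1 *: L0] these are the rows of [1 - L] outside [P], those of path nodes being
   multiplied by [s] so that [s = 0] makes sense. *)
pose A (s : R) : 'M[R]_m := \matrix_(a, b)
  (if a \in P then 0 else ((if U a then s else 1) * (a == b)%:R - L0 a b)).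
pose O1 : 'M[R]_m := \matrix_(a, b) (if a \in Y then O a b else 0).
pose G (s : R) := (A s)^T *m A s + O1^T *m O1.
have uc := @unifn_closed R.
have kA : mx_in (@unifn R) A.
  move=> a b; apply: (rc_ext uc (f := fun s =>
    if a \in P then 0 else ((if U a then s else 1) * (a == b)%:R - L0 a b))).
    by move=> s; rewrite [RHS]mxE.
  case: (a \in P); first exact: (rc_const uc).
  apply: (rc_sub uc); last exact: (rc_const uc).
  apply: (rc_mul uc); last exact: (rc_const uc).
  by case: (U a); [exact: unifn_id | exact: (rc_const uc)].
have kG : unifn (fun s => \det (G s)).
  apply: (rc_det uc); apply: (rc_addmx uc); last exact: (rc_cstmx uc).
  by apply: (rc_mulmx uc) => //; apply: (rc_trmx uc).
have rowA (s : R) (x : 'cV[R]_m) a : a \notin P ->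
    (A s *m x) a ord0 = (if U a then s else 1) * x a ord0 - (L0 *m x) a ord0.
  move=> aP; rewrite !mxE (bigD1 a) //= [A s a a]mxE (negbTE aP) eqxx mulr1.
  rewrite [in RHS](bigD1 a) //= mulrBl opprD addrA; congr (_ + _).
  rewrite -sumrN; apply: eq_bigr => b nb.
  by rewrite [A s a b]mxE (negbTE aP) eq_sym (negbTE nb) mulr0 sub0r mulNr.
have L0U (x : 'cV[R]_m) a : ~~ U a -> (L0 *m x) a ord0 = 0.
  move=> na; rewrite mxE big1 // => b _; rewrite mxE.
  by case E : (nx a b); rewrite ?mul0r //; rewrite (nxU _ _ E) in na.
have rowO (x : 'cV[R]_m) a : a \in Y -> (O1 *m x) a ord0 = (O *m x) a ord0.
  by move=> aY; rewrite !mxE; apply: eq_bigr => b _; rewrite [O1 a b]mxE aY.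
(* At [s = 0] the row of a path node kills the coordinate of its successor. Only the tops [r j]
   survive, and the nonzero minor of [O] kills those. *)
have G0 : \det (G 0) != 0.
  apply/det_injP => x /gram_ker[Ax Ox].
  have xtop b : (forall j, b != r j) -> x b ord0 = 0.
    move=> nr; have [ub|nb] := boolP (U b).
      have [a nab] := has_pred _ ub nr.
      have := rowA 0 x a (nx_P _ _ nab).
      rewrite Ax (nxU _ _ nab) mul0r sub0r mxE => /esym/eqP.
      rewrite oppr_eq0 mxE (bigD1 b) //= mxE nab mul1r big1 ?addr0 => [/eqP //|c nc].
      rewrite mxE; case E: (nx a c); last by rewrite mul0r.
      by rewrite (nx_fun _ _ _ nab E) eqxx in nc.
    have bP : b \notin P.
      apply: contra nb => /Pp[i ->]; apply/existsP; exists i; exact: pS.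
    by have := rowA 0 x b bP; rewrite Ax L0U // (negbTE nb) mul1r subr0 mxE.
  pose z : 'cV[R]_k := \col_j x (r j) ord0.
  have /det_injP/(_ z) z0 := dO.
  have {}z0 : z = 0.
    apply: z0; apply/colP => i.
    have yY : y i \in Y by rewrite yE -eY inE map_f.
    have := rowO x _ yY; rewrite Ox !mxE => {2}->.
    rewrite (bigID (mem [set r j | j : 'I_k])) /= [X in _ = _ + X]big1 => [|b].
      by rewrite addr0 big_imset /= => [|? ? _ _ /r_inj //]; apply: eq_big => [j|j _];
        rewrite ?inE // !mxE.
    move=> nb; rewrite xtop ?mulr0 // => j; apply: contraNneq nb => ->.
    by apply: imset_f.
  apply/colP => b; rewrite [RHS]mxE.
  case: (pickP (fun j => b == r j)) => [j /eqP ->|nr].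
    by move/colP/(_ j): z0; rewrite !mxE.
  by apply: xtop => j; rewrite nr.
have [pG hG] := kG.
have npG : pG != 0 by apply: contraNneq G0 => e; rewrite -hG e horner0.
(* Avoiding the roots of the characteristic polynomial keeps [s%:M - L0], hence [1 - L],
   invertible. *)
have ncp : char_poly L0 != 0 by apply: monic_neq0; apply: char_poly_monic.
have [s [s0 _]] := nonroot_itv (mulf_neq0 npG ncp) (@ltr01 R).
rewrite hornerM mulf_eq0 negb_or hG => /andP[dG dc].
have ns : s != 0 by rewrite gt_eqF.
pose L := s^-1 *: L0.
have LE : 1%:M - L = s^-1 *: (s%:M - L0).
  by rewrite scalerBr scale_scalar_mx mulVf.
have uL : 1%:M - L \in unitmx.
  rewrite LE unitmxE unitfE detZ mulf_neq0 ?expf_neq0 ?invr_neq0 //.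
  move: dc; rewrite -horner_evalE /char_poly -det_map_mx; congr (\det _ != 0).
  apply/matrixP => a b; rewrite !mxE /= horner_evalE.
  by rewrite hornerD hornerN hornerC hornerMn hornerX.
exists (L, O); first split=> //.
  split=> // a b nD; rewrite !mxE; case E: (nx a b); last by rewrite mulr0.
  by rewrite (nxD _ _ E) in nD.
move=> z zP zY /=; pose x := invmx (1%:M - L) *m z.
have zE : (1%:M - L) *m x = z by rewrite mulKVmx.
suff x0 : x = 0 by rewrite -zE x0 mulmx0.
have /det_injP := dG; apply.
rewrite /G mulmxDl -!mulmxA.
have -> : A s *m x = 0.
  apply/colP => a; rewrite [RHS]mxE; have [aP|aP] := boolP (a \in P).
    by rewrite mxE big1 // => b _; rewrite mxE aP mul0r.
  rewrite rowA //; have := zP a aP; rewrite -zE LE -scalemxAl mulmxBl mul_scalar_mx !mxE.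
  move=> /eqP; rewrite mulf_eq0 invr_eq0 (negbTE ns) /= => /eqP e.
  case: ifP => ua; first by [].
  move: e; have := L0U x a (negbT ua); rewrite mxE => ->.
  by rewrite !subr0 => /eqP; rewrite mulf_eq0 (negbTE ns) /= mul1r => /eqP.
rewrite mulmx0 add0r.
suff -> : O1 *m x = 0 by rewrite mulmx0.
apply/colP => a; rewrite [RHS]mxE; have [aY|aY] := boolP (a \in Y).
  by rewrite rowO // /x mulmxA; apply: zY.
by rewrite mxE big1 // => b _; rewrite mxE (negbTE aY) mul0r.
Qed.

End Realization.

(** * Gram determinants as a test of injectivity *)

Section Gram.

Variables (R : rcfType) (m : nat).
Implicit Types (Y P : {set 'I_m}).

Definition maskmx Y P (A : 'M[R]_m) : 'M[R]_m :=
  \matrix_(a, b) (if (a \in Y) && (b \in P) then A a b else 0).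

Definition offmx P : 'M[R]_m := \matrix_(a, b) ((a == b) && (a \notin P))%:R.

(** The Gram matrix of the selected block stacked on the coordinates outside [P]. Over a real field
    one determinant thus decides injectivity for any sizes of [Y] and [P], and the same matrix gives
    normal equations. *)
Definition gram Y P (A : 'M[R]_m) : 'M[R]_m :=
  (maskmx Y P A)^T *m maskmx Y P A + (offmx P)^T *m offmx P.

Lemma offmxE P (x : 'cV[R]_m) a : (offmx P *m x) a ord0 = if a \in P then 0 else x a ord0.
Proof.
rewrite mxE (bigD1 a) //= big1 ?addr0 => [|b nb].
  by rewrite mxE eqxx /=; case: (a \in P); rewrite ?mul0r ?mul1r.
by rewrite mxE eq_sym (negbTE nb) mul0r.
Qed.

Lemma maskmxE Y P A (x : 'cV[R]_m) a : (forall u, u \notin P -> x u ord0 = 0) ->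
  (maskmx Y P A *m x) a ord0 = if a \in Y then (A *m x) a ord0 else 0.
Proof.
move=> hx; rewrite mxE; case: ifP => aY; last first.
  by rewrite big1 // => b _; rewrite mxE aY mul0r.
rewrite mxE; apply: eq_bigr => b _; rewrite mxE aY /=.
by have [//|/hx ->] := boolP (b \in P); rewrite !mulr0.
Qed.

Lemma gramP Y P A : inj_on A Y P <-> \det (gram Y P A) != 0.
Proof.
split=> [h|/det_injP h z zP zY].
  apply/det_injP => x /gram_ker[mx ox].
  have xP u : u \notin P -> x u ord0 = 0.
    by move=> uP; have := offmxE P x u; rewrite ox mxE (negbTE uP).
  apply: h => // y yY; have := maskmxE Y A y xP.
  by rewrite mx yY mxE.
apply: h; rewrite /gram mulmxDl -!mulmxA.
have -> : offmx P *m z = 0.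
  by apply/colP => a; rewrite offmxE mxE; case: ifPn => // /zP.
have -> : maskmx Y P A *m z = 0.
  by apply/colP => a; rewrite (maskmxE Y A a zP) [RHS]mxE; case: ifPn => // /zY.
by rewrite !mulmx0 addr0.
Qed.

Lemma rc_gram E (K : (E -> R) -> Prop) (cK : ring_closed K) Y P (A : E -> 'M[R]_m) :
  mx_in K A -> mx_in K (fun x => gram Y P (A x)).
Proof.
move=> kA; apply: (rc_addmx cK); last exact: (rc_cstmx cK).
have km : mx_in K (fun x => maskmx Y P (A x)).
  move=> a b; apply: (rc_ext cK (f := fun x => if (a \in Y) && (b \in P) then A x a b else 0)).
    by move=> x; rewrite [RHS]mxE.
  by case: (_ && _); [exact: kA | exact: (rc_const cK)].
by apply: (rc_mulmx cK) => //; apply: (rc_trmx cK).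
Qed.

End Gram.

(** * Rational identifiability *)

Section RationalFunctions.

Variables (R : rcfType) (m : nat).
Notation point := ('M[R]_m * 'M[R]_m)%type.
Variable good : point -> Prop.
Notation Sig x := (phiG x.1 x.2).

Definition ratfn (h : point -> R) : Prop :=
  exists p q : mpoly R ('I_m * 'I_m), forall x, good x ->
    meval (matrix_coord (Sig x)) q != 0 /\
    meval (matrix_coord (Sig x)) p / meval (matrix_coord (Sig x)) q = h x.

Lemma ratfn_closed : ring_closed ratfn.
Proof.
split=> [c|f g [p [q hf]] [p' [q' hg]]|f g [p [q hf]] [p' [q' hg]]|f g e [p [q hf]]].
- by exists (MPconst _ c), (MPconst _ 1) => x _ /=; rewrite oner_neq0 divr1.
- exists (MPadd (MPmul p q') (MPmul p' q)), (MPmul q q') => x gx /=.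
  have [h1 <-] := hf x gx; have [h2 <-] := hg x gx.
  by rewrite mulf_neq0 // addf_div.
- exists (MPmul p p'), (MPmul q q') => x gx /=.
  have [h1 <-] := hf x gx; have [h2 <-] := hg x gx.
  by rewrite mulf_neq0 // mulf_div.
- by exists p, q => x gx; have [h1 h2] := hf x gx; rewrite -e.
Qed.

Lemma ratfn_on f g : (forall x, good x -> f x = g x) -> ratfn f -> ratfn g.
Proof. by move=> e [p [q hf]]; exists p, q => x gx; rewrite -e //; apply: hf. Qed.

Lemma ratfn_Sig : mx_in ratfn (fun x => Sig x).
Proof.
move=> i j; exists (MPvar _ (i, j)), (MPconst _ 1) => x _ /=.
by rewrite oner_neq0 divr1.
Qed.

Lemma ratfn_inv f : (forall x, good x -> f x != 0) -> ratfn f -> ratfn (fun x => (f x)^-1).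
Proof.
move=> nf [p [q hf]]; exists q, p => x gx.
have [h1 h2] := hf x gx; have := nf x gx; rewrite -h2 => h3.
split; last by rewrite invf_div.
by apply: contraNneq h3 => ->; rewrite mul0r.
Qed.

Lemma ratfn_invmx n (A : point -> 'M[R]_n) : (forall x, good x -> \det (A x) != 0) ->
  mx_in ratfn A -> mx_in ratfn (fun x => invmx (A x)).
Proof.
move=> nA kA i j.
apply: (@ratfn_on (fun x => (\det (A x))^-1 * (\adj (A x)) i j)).
  by move=> x gx; rewrite /invmx unitmxE unitfE nA // [RHS]mxE.
apply: (rc_mul ratfn_closed).
  by apply: ratfn_inv => //; apply: (rc_det ratfn_closed).
exact: (rc_adj ratfn_closed).
Qed.

End RationalFunctions.

Section Identification.

Variables (R : rcfType) (m : nat) (D B : rel 'I_m).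
Hypothesis symB : symmetric B.
Notation point := ('M[R]_m * 'M[R]_m)%type.
Implicit Types (L O : 'M[R]_m).

Lemma phi_cov L O : 1%:M - L \in unitmx ->
  (1%:M - L)^T *m phiG L O *m (1%:M - L) = O.
Proof.
move=> uL; rewrite /phiG !mulmxA -trmx_mul mulVmx // trmx1 mul1mx.
by rewrite -mulmxA mulVmx // mulmx1.
Qed.

Lemma phi_ht L O : 1%:M - L \in unitmx -> (1%:M - L)^T *m phiG L O = htmx L O.
Proof. by move=> uL; rewrite -[in RHS](phi_cov O uL) /htmx mulmxK. Qed.

Lemma phi_sym L O : O^T = O -> (phiG L O)^T = phiG L O.
Proof. by move=> sO; rewrite /phiG !trmx_mul trmxK sO mulmxA. Qed.

(* the row vectors supported on the descendants of [b] form an invariant subspace of [1 - L] *)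
Lemma invmx_connect L b y : in_RDreg D L -> ~~ connect D b y ->
  invmx (1%:M - L) b y = 0.
Proof.
move=> [DL uL] nby; set A := 1%:M - L in uL *.
pose pC : 'M[R]_m := \matrix_(i, j) ((i == j) && connect D b i)%:R.
have rowC (X : 'M[R]_m) i j : (pC *m X) i j = (connect D b i)%:R * X i j.
  rewrite mxE (bigD1 i) //= mxE eqxx big1 ?addr0 // => k nk.
  by rewrite mxE eq_sym (negbTE nk) mul0r.
have colC (X : 'M[R]_m) i j : (X *m pC) i j = X i j * (connect D b j)%:R.
  rewrite mxE (bigD1 j) //= mxE eqxx big1 ?addr0 // => k nk.
  by rewrite mxE (negbTE nk) mulr0.
have CA : pC *m A = pC *m A *m pC.
  apply/matrixP => i j; rewrite colC rowC.
  have [bj|nbj] := boolP (connect D b j); first by rewrite mulr1.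
  rewrite mulr0; have [bi|nbi] := boolP (connect D b i); last by rewrite mul0r.
  have nij : i != j by apply: contraNneq nbj => <-.
  have nD : ~~ D i j by apply: contra nbj => /connect1; apply: connect_trans.
  by rewrite !mxE (negbTE nij) DL // subr0 mulr0.
have sA : (pC *m A <= pC)%MS by rewrite CA submxMl.
have eA : (pC *m A == pC)%MS.
  by rewrite -(geq_leqif (mxrank_leqif_eq sA)) mxrankMfree // row_free_unit.
have sV : (pC *m invmx A <= pC)%MS.
  have /andP[_ h] := eA.
  by have := submxMr (invmx A) h; rewrite mulmxK.
have /submxP[X eX] := sV.
have := rowC (invmx A) b y; rewrite connect0 mul1r eX colC (negbTE nby) mulr0.
by [].
Qed.

Lemma htmx_hreach L O v y : in_preTheta D B L O -> ~~ hreach D B v y ->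
  htmx L O v y = 0.
Proof.
move=> [rL _ BO] nr; rewrite mxE big1 // => b _.
have [vb|nvb] := boolP ((v == b) || B v b).
  rewrite invmx_connect ?mulr0 //; apply: contra nr => bc.
  by apply/existsP; exists b; rewrite vb.
by move: nvb; rewrite negb_or => /andP[h1 h2]; rewrite BO // mul0r.
Qed.

Variables (Y : 'I_m -> {set 'I_m}) (prec : rel 'I_m).
Hypotheses (ord_prec : strict_total_order prec) (hY : forall v, HTC D B v (Y v))
  (hprec : forall v w, w \in Y v -> htr D B v w -> prec w v).

Definition far v y := (y \notin v |: sib B v) && ~~ hreach D B v y.

(** For far [y], closure under parents makes row [y] of [(1 - L)^T S] a combination of rows of [S]
    at far nodes, as [eqs_inj] requires. *)
Lemma far_parent v a y : D a y -> far v y -> far v a.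
Proof.
move=> ay /andP[ny nr]; apply/andP; split; apply: contra nr.
  by move=> /(hreach_near symB); apply; apply: connect1.
by move=> /hreach_trans; apply; apply: connect1.
Qed.

Notation H x := (htmx x.1 x.2).
Notation Sig x := (phiG x.1 x.2).
Definition good (x : point) : Prop :=
  preTheta D B x /\ forall v, \det (gram (Y v) (pa D v) (H x)) != 0.

(* The equations for the column [v] of [L]. For a far [y] the relation
   [(S (1 - L)) y v = 0] holds without the factor [(1 - L)^T], so that the
   possibly unknown column [y] of [L] is not needed. *)
Definition eqs v (x : point) : 'M[R]_m := \matrix_(y, u)
  (if far v y then Sig x y u
   else if y \in Y v then ((1%:M - x.1)^T *m Sig x) y u else 0).

Lemma near_Y v y : y \in Y v -> ~~ far v y -> htr D B v y.
Proof.
move=> yY nf; have [_ dY _] := hY v.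
have ny : y \notin v |: sib B v.
  apply/negP => h; have : y \in Y v :&: (v |: sib B v) by rewrite inE yY.
  by rewrite dY inE.
by apply/htrP; split=> //; move: nf; rewrite /far ny /= negbK.
Qed.

(** Equivalently, [eqs v x] annihilates column [v] of [1 - L]. For far [y] the product is [H x v y],
    zero because [v] does not reach [y]; for the other [y] in [Y v] it is [x.2 y v], zero because
    [y] is neither [v] nor a sibling of [v]. *)
Lemma eqs_col v x : preTheta D B x -> eqs v x *m col v x.1 = col v (eqs v x).
Proof.
move=> tx; have [[DL uL] sO BO] := tx.
suff e : eqs v x *m col v (1%:M - x.1) = 0.
  move/eqP: e; rewrite linearB /= mulmxBr subr_eq0 => /eqP <-.
  by rewrite !colE mul1mx.
apply/colP => y; rewrite [RHS]mxE.
have -> : (eqs v x *m col v (1%:M - x.1)) y ord0 = \sum_u eqs v x y u * (1%:M - x.1) u v.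
  by rewrite mxE; apply: eq_bigr => u _; rewrite [col _ _ _ _]mxE.
have [fy|nfy] := boolP (far v y).
  have -> : \sum_u eqs v x y u * (1%:M - x.1) u v = H x v y.
    rewrite -phi_ht // -[in RHS]phi_sym // -trmx_mul [RHS]mxE [RHS]mxE.
    by apply: eq_bigr => u _; rewrite [eqs _ _ _ _]mxE fy.
  by apply: htmx_hreach => //; case/andP: fy.
have [yY|nY] := boolP (y \in Y v); last first.
  by rewrite big1 // => u _; rewrite mxE (negbTE nfy) (negbTE nY) mul0r.
have -> : \sum_u eqs v x y u * (1%:M - x.1) u v = x.2 y v.
  rewrite -[in RHS](phi_cov x.2 uL) [RHS]mxE; apply: eq_bigr => u _.
  by rewrite [eqs _ _ _ _]mxE (negbTE nfy) yY.
have /htrP[] // := near_Y yY nfy; rewrite !inE negb_or => /andP[nyv nB] _.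
by apply: BO.
Qed.

Lemma eqs_inj v x : good x -> inj_on (eqs v x) [set: 'I_m] (pa D v).
Proof.
move=> [tx /(_ v)/gramP hx] z zP zY; apply: hx => // y yY.
have {}zY a : (eqs v x *m z) a ord0 = 0 by apply: zY; rewrite inE.
have [[DL uL] _ _] := tx.
have farz a : far v a -> (Sig x *m z) a ord0 = 0.
  move=> fa; rewrite -(zY a) !mxE; apply: eq_bigr => u _.
  by rewrite [eqs _ _ _ _]mxE fa.
have [fy|nfy] := boolP (far v y); last first.
  rewrite -(zY y) -phi_ht // !mxE; apply: eq_bigr => u _.
  by rewrite [eqs _ _ _ _]mxE (negbTE nfy) yY.
rewrite -phi_ht // -mulmxA mxE big1 // => a _.
have [ay|nay] := eqVneq a y; first by rewrite ay farz ?mulr0.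
have [Day|nD] := boolP (D a y); first by rewrite farz ?mulr0 //; apply: far_parent fy.
by rewrite !mxE (negbTE nay) DL // subr0 mul0r.
Qed.

(** Strong induction on the number of predecessors of [v]: the rows of [eqs v] that involve [L] use
    only columns [y] with [prec y v]. *)
Lemma ratfn_col v u : ratfn good (fun x => x.1 u v).
Proof.
have rc := ratfn_closed good.
have [prec_irr prec_tr _] := ord_prec.
have [n] := ubnP #|[set w | prec w v]|; elim: n v u => // n IH v u le_n.
have kT : mx_in (ratfn good) (eqs v).
  move=> y w; apply: (rc_ext rc (f := fun x => if far v y then Sig x y w
      else if y \in Y v then ((1%:M - x.1)^T *m Sig x) y w else 0)).
    by move=> x; rewrite [RHS]mxE.
  case: (boolP (far v y)) => [_|nf]; first exact: ratfn_Sig.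
  case: (boolP (y \in Y v)) => [yY|_]; last exact: (rc_const rc).
  have pyv := hprec yY (near_Y yY nf).
  have ltn_yv : (#|[set w | prec w y]| < #|[set w | prec w v]|)%N.
    apply: proper_card; apply/properP; split.
      by apply/subsetP => a; rewrite !inE => ay; apply: prec_tr pyv.
    by exists y; rewrite inE // prec_irr.
  apply: (rc_ext rc (f := fun x => \sum_a ((a == y)%:R - x.1 a y) * Sig x a w)).
    by move=> x; rewrite mxE; apply: eq_bigr => a _; rewrite !mxE.
  apply: (rc_sum rc) => a; apply: (rc_mul rc); last exact: ratfn_Sig.
  apply: (rc_sub rc); first exact: (rc_const rc).
  by apply: IH; apply: leq_trans ltn_yv _; rewrite -ltnS.
pose A x := maskmx [set: 'I_m] (pa D v) (eqs v x).
pose C x := gram [set: 'I_m] (pa D v) (eqs v x).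
have kA : mx_in (ratfn good) A.
  move=> a b; apply: (rc_ext rc (f := fun x => if b \in pa D v then eqs v x a b else 0)).
    by move=> x; rewrite [RHS]mxE in_setT.
  by case: (b \in pa D v); [exact: kT | exact: (rc_const rc)].
have dC x : good x -> \det (C x) != 0 by move=> gx; apply/gramP; apply: eqs_inj.
(* These are the normal equations of the overdetermined system [eqs_col]; the [offmx] part of [C]
   vanishes on the solution, which is supported on [pa D v]. *)
apply: (@ratfn_on _ _ good (fun x => (invmx (C x) *m ((A x)^T *m col v (eqs v x))) u ord0)); last first.
  apply: (rc_mulmx rc (m := m) (n := m) (p := 1)).
    by apply: ratfn_invmx => //; apply: (rc_gram rc).
  apply: (rc_mulmx rc); first exact: (rc_trmx rc).
  by move=> a b; apply: (rc_ext rc _ (kT a v)) => x; rewrite [RHS]mxE.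
move=> x gx; have [tx _] := gx; have [[DL uL] _ _] := tx.
have Lsupp w : w \notin pa D v -> col v x.1 w ord0 = 0.
  by rewrite inE mxE => nD; apply: DL.
suff -> : (A x)^T *m col v (eqs v x) = C x *m col v x.1.
  by rewrite mulKmx ?unitmxE ?unitfE ?dC // mxE.
rewrite /C /gram mulmxDl -!mulmxA.
have -> : offmx R (pa D v) *m col v x.1 = 0.
  by apply/colP => a; rewrite offmxE [RHS]mxE; case: ifPn => // /Lsupp.
rewrite mulmx0 addr0 -(eqs_col v tx); congr (_ *m _).
by apply/colP => a; rewrite (maskmxE _ _ _ Lsupp) inE.
Qed.

Lemma HTC_rationally_identifiable : rationally_identifiable R D B.
Proof.
pose f v (x : point) := \det (gram (Y v) (pa D v) (H x)).
have rc := regfn_closed R D B.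
have kf v : regfn D B (f v).
  by apply: (rc_det rc); apply: (rc_gram rc); apply: regfn_htmx.
have nf v : exists2 x, preTheta D B x & f v x != 0.
  have [_ _ [ts [sys hts]]] := hY v.
  have [x tx ix] := inj_of_htsystem R symB sys hts.
  by exists x => //; apply/gramP.
pose h x := \prod_v f v x.
have kh : regfn D B h by apply: (rc_prod rc).
have [|x tx hx] := @dense_prod R m D B 'I_m (index_enum 'I_m) f (fun v _ => kf v) (fun v _ => nf v).
  by exists (0, 1%:M); apply: preTheta1.
have [|L0 [O0 [T0 h0]]] := dense_Theta kh.
  by exists x => //; apply/prodf_neq0 => v _; apply: hx; apply: mem_index_enum.
(* The polynomial [w] is [h] times a power of [detL]. On the parameter space it vanishes exactly
   where [h] does, so it serves as the exceptional set. *)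
have [N [p [[w hw] hp]]] := kh.
have [rcL rcO] : (forall u v, ratfn good (fun x => x.1 u v)) /\
    (forall u v, ratfn good (fun x => x.2 u v)).
  have kL u v := ratfn_col v u.
  split=> // u v; have rg := ratfn_closed good.
  have kIL : mx_in (ratfn good) (fun x => 1%:M - x.1).
    by apply: (rc_submx rg) => //; apply: (rc_cstmx rg).
  apply: (@ratfn_on _ _ good (fun x => ((1%:M - x.1)^T *m Sig x *m (1%:M - x.1)) u v)).
    by move=> y [[[_ uL] _ _] _]; rewrite phi_cov.
  apply: (rc_mulmx rg) => //; apply: (rc_mulmx rg); last exact: ratfn_Sig.
  exact: (rc_trmx rg).
have rat (z : param_var m) : exists pq : mpoly R ('I_m * 'I_m) * mpoly R ('I_m * 'I_m),
    forall x, good x -> meval (matrix_coord (Sig x)) pq.2 != 0 /\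
    meval (matrix_coord (Sig x)) pq.1 / meval (matrix_coord (Sig x)) pq.2 = param_coord x.1 x.2 z.
  by case: z => -[u v]; [have [p1 [q1 hpq]] := rcL u v | have [p1 [q1 hpq]] := rcO u v];
    exists (p1, q1).
have [psi hpsi] := @fin_all_exists ('I_m * 'I_m + 'I_m * 'I_m)%type _ _ rat.
exists [:: w], psi; split.
  exists L0, O0; split=> //; rewrite /outside_alg /= orbF.
  have := hp (L0, O0) (Theta_preTheta T0); rewrite -hw /pcoord /= => <-.
  by rewrite mulf_neq0 // expf_neq0 // (detL_neq0 (Theta_preTheta T0)).
move=> L O tLO; rewrite /outside_alg /= orbF => nw z.
apply: (hpsi z (L, O)); split; first exact: Theta_preTheta.
move=> v; have := hp (L, O) (Theta_preTheta tLO); rewrite -hw => e.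
move: nw; rewrite -[meval _ _]e mulf_eq0 negb_or => /andP[_ /prodf_neq0 hv].
exact: (hv v).
Qed.

End Identification.

(** * Projections of real algebraic sets to a line *)

Section Projection.

Variable R : rcfType.

Definition opt (X : Type) (e : X -> R) (z : R) (o : option X) : R :=
  if o is Some x then e x else z.

(* [p] as a polynomial in the distinguished variable [None] *)
Fixpoint uni (X : Type) (e : X -> R) (p : mpoly R (option X)) : {poly R} :=
  match p with
  | MPconst c => c%:P
  | MPvar o => if o is Some x then (e x)%:P else 'X
  | MPadd p q => uni e p + uni e q
  | MPmul p q => uni e p * uni e q
  end.

Lemma uniE X (e : X -> R) p z : (uni e p).[z] = meval (opt e z) p.
Proof.
elim: p => /= [c|[x|]|p IHp q IHq|p IHp q IHq].
- by rewrite hornerC.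
- by rewrite hornerC.
- by rewrite hornerX.
- by rewrite hornerD IHp IHq.
- by rewrite hornerM IHp IHq.
Qed.

Lemma meval_ext X (e e' : X -> R) p : e =1 e' -> meval e p = meval e' p.
Proof. by move=> h; elim: p => //= p -> q ->. Qed.

Variables X Q : finType.
Notation V := (option X + Q)%type.

Definition code (v : V) : nat := enum_rank v.

Fixpoint term_of (p : mpoly R V) : GRing.term R :=
  match p with
  | MPconst c => GRing.Const c
  | MPvar v => GRing.Var _ (code v)
  | MPadd p q => GRing.Add (term_of p) (term_of q)
  | MPmul p q => GRing.Mul (term_of p) (term_of q)
  end.

Lemma eval_term_of s p : GRing.eval s (term_of p) = meval (fun v => s`_(code v)) p.
Proof. by elim: p => //= p -> q ->. Qed.

Lemma rterm_term_of p : GRing.rterm (term_of p).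
Proof. by elim: p => //= p -> q ->. Qed.

Definition decode (n : nat) : option V := omap enum_val (insub n : option 'I_#|{: V}|).

Lemma codeK : pcancel code decode.
Proof. by move=> v; rewrite /decode /code valK /= enum_rankK. Qed.

Definition env (f : V -> R) : seq R := mkseq (fun n => oapp f 0 (decode n)) #|{: V}|.

Lemma nth_env f n : (env f)`_n = oapp f 0 (decode n).
Proof.
have [h|h] := ltnP n #|{: V}|; first by rewrite nth_mkseq.
by rewrite nth_default ?size_mkseq // /decode insubN // -leqNgt.
Qed.

(** The variables from [Q] will be bound by quantifiers; 0 is a placeholder for them. *)
Definition env0 (e : X -> R) z := env (fun v => if v is inl o then opt e z o else 0).

Fixpoint mpoly_of (t : GRing.term R) : mpoly R (option X) :=
  match t with
  | GRing.Var n => if decode n is Some (inl o) then MPvar _ o else MPconst _ 0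
  | GRing.Const c => MPconst _ c
  | GRing.NatConst n => MPconst _ n%:R
  | GRing.Add u v => MPadd (mpoly_of u) (mpoly_of v)
  | GRing.Opp u => MPmul (MPconst _ (-1)) (mpoly_of u)
  | GRing.NatMul u n => MPmul (MPconst _ n%:R) (mpoly_of u)
  | GRing.Mul u v => MPmul (mpoly_of u) (mpoly_of v)
  | GRing.Exp u n => iter n (MPmul (mpoly_of u)) (MPconst _ 1)
  | GRing.Inv _ => MPconst _ 0
  end.

Lemma meval_mpoly_of e z t : GRing.rterm t ->
  meval (opt e z) (mpoly_of t) = GRing.eval (env0 e z) t.
Proof.
elim: t => //= [n _|u IHu v IHv /andP[/IHu -> /IHv ->] //|u IHu /IHu ->|u IHu n /IHu ->
  |u IHu v IHv /andP[/IHu -> /IHv ->] //|u IHu n /IHu e1].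
- by rewrite nth_env; case: (decode n) => [[o|q]|].
- by rewrite mulN1r.
- by rewrite mulr_natl.
- by elim: n => //= n ->; rewrite e1 exprS.
Qed.

(** The truth of an atom depends only on the sign of the difference of its two sides, whatever the
    comparison. *)
Fixpoint atoms (f : ord.formula R) : seq (mpoly R (option X)) :=
  match f with
  | ord.Equal t u | ord.Lt t u | ord.Le t u =>
      [:: MPadd (mpoly_of t) (MPmul (MPconst _ (-1)) (mpoly_of u))]
  | ord.And f g | ord.Or f g | ord.Implies f g => atoms f ++ atoms g
  | ord.Not f => atoms f
  | _ => [::]
  end.

(** Continuity at [z0] with tolerance the absolute value of [p.[z0]] excludes a sign change. *)
Lemma sgr_stable (p : {poly R}) z0 : p = 0 \/ p.[z0] != 0 ->
  exists2 d, 0 < d & forall z, `|z - z0| < d -> Num.sg p.[z] = Num.sg p.[z0].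
Proof.
case=> [->|nz]; first by exists 1 => // z _; rewrite !horner0.
have n0 : 0 < `|p.[z0]| by rewrite normr_gt0.
have [d d0 hd] := poly_cont z0 p n0; exists d => // z /hd.
set a := p.[z]; set b := p.[z0].
case: (ltrgt0P b) => b0; last by move: nz; rewrite -/b b0 eqxx.
- rewrite ltr_distl => /andP[h _]; rewrite !gtr0_sg //; lra.
- rewrite ltr_distl => /andP[_ h]; rewrite !ltr0_sg //; lra.
Qed.

Definition generic (e : X -> R) z (qs : seq (mpoly R (option X))) : Prop :=
  forall q, List.In q qs -> uni e q = 0 \/ (uni e q).[z] != 0.

Lemma qf_eval_stable e z0 (f : ord.formula R) : ord.rformula f ->
  generic e z0 (atoms f) ->
  exists2 d, 0 < d & forall z, `|z - z0| < d ->
    ord.qf_eval (env0 e z) f = ord.qf_eval (env0 e z0) f.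
Proof.
have atom t u : GRing.rterm t -> GRing.rterm u ->
    generic e z0 [:: MPadd (mpoly_of t) (MPmul (MPconst _ (-1)) (mpoly_of u))] ->
    exists2 d, 0 < d & forall z, `|z - z0| < d ->
    Num.sg (GRing.eval (env0 e z) t - GRing.eval (env0 e z) u)
    = Num.sg (GRing.eval (env0 e z0) t - GRing.eval (env0 e z0) u).
  move=> rt ru /(_ _ (or_introl erefl)) /sgr_stable[d d0 hd]; exists d => // z /hd.
  by rewrite !uniE /= !meval_mpoly_of // !mulN1r.
have two f1 f2 (h1 : exists2 d, 0 < d & forall z, `|z - z0| < d ->
      ord.qf_eval (env0 e z) f1 = ord.qf_eval (env0 e z0) f1)
    (h2 : exists2 d, 0 < d & forall z, `|z - z0| < d ->
      ord.qf_eval (env0 e z) f2 = ord.qf_eval (env0 e z0) f2) :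
    exists2 d, 0 < d & forall z, `|z - z0| < d ->
      ord.qf_eval (env0 e z) f1 = ord.qf_eval (env0 e z0) f1 /\
      ord.qf_eval (env0 e z) f2 = ord.qf_eval (env0 e z0) f2.
  case: h1 => d1 d10 h1; case: h2 => d2 d20 h2.
  exists (Num.min d1 d2); first by rewrite lt_min d10.
  by move=> z; rewrite lt_min => /andP[/h1 -> /h2 ->].
have gcat s1 s2 : generic e z0 (s1 ++ s2) -> generic e z0 s1 /\ generic e z0 s2.
  by move=> g; split=> q qs; apply: g; apply: List.in_or_app; [left|right].
elim: f => //=.
- by move=> b _ _; exists 1.
- move=> t u /andP[rt ru] /(atom t u rt ru)[d d0 hd]; exists d => // z /hd.
  move: (GRing.eval _ t) (GRing.eval _ u) (GRing.eval _ t) (GRing.eval _ u) => a b c d1 e1.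
  by rewrite -(subr_eq0 a) -(subr_eq0 c) -(sgr_eq0 (a - b)) -(sgr_eq0 (c - d1)) e1.
- move=> t u /andP[rt ru] /(atom t u rt ru)[d d0 hd]; exists d => // z /hd.
  move: (GRing.eval _ t) (GRing.eval _ u) (GRing.eval _ t) (GRing.eval _ u) => a b c d1 e1.
  by rewrite -(subr_lt0 b) -(subr_lt0 d1) -(sgr_lt0 (a - b)) -(sgr_lt0 (c - d1)) e1.
- move=> t u /andP[rt ru] /(atom t u rt ru)[d d0 hd]; exists d => // z /hd.
  move: (GRing.eval _ t) (GRing.eval _ u) (GRing.eval _ t) (GRing.eval _ u) => a b c d1 e1.
  by rewrite -(subr_le0 b) -(subr_le0 d1) -(sgr_le0 (a - b)) -(sgr_le0 (c - d1)) e1.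
- move=> f1 IH1 f2 IH2 /andP[r1 r2] /gcat[g1 g2].
  have [d d0 hd] := two _ _ (IH1 r1 g1) (IH2 r2 g2).
  by exists d => // z /hd[-> ->].
- move=> f1 IH1 f2 IH2 /andP[r1 r2] /gcat[g1 g2].
  have [d d0 hd] := two _ _ (IH1 r1 g1) (IH2 r2 g2).
  by exists d => // z /hd[-> ->].
- move=> f1 IH1 f2 IH2 /andP[r1 r2] /gcat[g1 g2].
  have [d d0 hd] := two _ _ (IH1 r1 g1) (IH2 r2 g2).
  by exists d => // z /hd[-> ->].
- move=> f IH rf g; have [d d0 hd] := IH rf g.
  by exists d => // z /hd ->.
- by move=> *; exists 1.
- by move=> *; exists 1.
Qed.

Definition solvable_at (Es : seq (mpoly R V)) (e : X -> R) z : Prop :=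
  exists w : Q -> R, forall p, List.In p Es ->
    meval (fun v => match v with inl o => opt e z o | inr q => w q end) p = 0.

Lemma holds_exists s ns (f : ord.formula R) :
  ord.holds s (foldr (fun n => ord.Exists n) f ns) <->
  exists s', (forall n, n \notin ns -> s'`_n = s`_n) /\ ord.holds s' f.
Proof.
elim: ns s => [|n ns IH] s /=.
  split=> [h|[s' [e h]]]; first by exists s.
  by apply: (@ord.eq_holds _ s') h => n; apply: e.
split=> [[x /IH[s' [e h]]]|[s' [e h]]].
  exists s'; split=> // k; rewrite inE negb_or => /andP[nk kn].
  by rewrite e // nth_set_nth /= (negbTE nk).
exists s'`_n; apply/IH; exists s'; split=> // k kn.
by rewrite nth_set_nth /=; case: eqP => [->//|/eqP nk]; apply: e; rewrite inE negb_or nk.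
Qed.

(* By quantifier elimination, solvability depends only on the signs of finitely
   many polynomials in [e] and [z], so it persists near any [z] avoiding the
   roots of those of them that do not vanish identically in [z]. *)
Lemma solvable_at_stable Es : exists qs, forall e z0,
  solvable_at Es e z0 -> generic e z0 qs ->
  exists2 d, 0 < d & forall z, `|z - z0| < d -> solvable_at Es e z.
Proof.
pose f0 := foldr (fun p => ord.And (ord.Equal (term_of p) (GRing.NatConst R 0)))
  (ord.Bool true) Es.
pose f1 := foldr (fun n => ord.Exists n) f0 [seq code (inr q) | q <- enum Q].
have holds0 s : ord.holds s f0 <->
    forall p, List.In p Es -> meval (fun v => s`_(code v)) p = 0.
  rewrite /f0; elim: (Es) => [|p ps IH] /=; first by split.
  rewrite eval_term_of; split=> [[h1 /IH h2] q [<-//|]|h]; first exact: h2.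
  by split; [apply: h; left | apply/IH => q hq; apply: h; right].
have holds1 e z : ord.holds (env0 e z) f1 <-> solvable_at Es e z.
  split=> [/holds_exists[s [es /holds0 hs]]|[w hw]].
    exists (fun q => s`_(code (inr q))) => p hp; rewrite -[RHS](hs p hp).
    apply: meval_ext => -[o|q] //.
    rewrite es ?nth_env ?codeK //; apply/mapP => -[q _].
    by move/(pcan_inj codeK).
  apply/holds_exists; exists (env (fun v => match v with inl o => opt e z o | inr q => w q end)).
  split=> [n nq|].
    rewrite !nth_env; case E : (decode n) => [[o|q]|] //=.
    case/negP: nq; apply/mapP; exists q; first by rewrite mem_enum.
    move: E; rewrite /decode; case: insubP => //= i _ <- [<-].
    by rewrite /code enum_valK.
  by apply/holds0 => p hp; rewrite -[RHS](hw p hp); apply: meval_ext => v; rewrite nth_env codeK.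
have r1 : ord.rformula f1.
  rewrite /f1; elim: (enum Q) => //= .
  by rewrite /f0; elim: (Es) => //= p ps ->; rewrite rterm_term_of.
have /andP[_ rg] := ord.quantifier_elim_wf (@qe_rcf.wf_QE_wproj R) r1.
set g := ord.quantifier_elim _ _ in rg.
have gP e z : reflect (ord.holds (env0 e z) f1) (ord.qf_eval (env0 e z) g).
  exact: (ord.quantifier_elim_rformP (@qe_rcf.wf_QE_wproj R) (@qe_rcf.valid_QE_wproj R)).
exists (atoms g) => e z0 /holds1/gP h0 gen.
have [d d0 hd] := qf_eval_stable rg gen.
by exists d => // z /hd ez; apply/holds1/gP; rewrite ez.
Qed.

End Projection.

(** * Infinite fibers *)

(** The determinant is additive in each row, so splitting the rows one after another leaves a
    nonzero term at every stage. *)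
Lemma det_row_split (F : fieldType) n (a b : 'M[F]_n) : \det (a + b) != 0 ->
  exists c : 'I_n -> bool, \det (\matrix_(i, j) (if c i then a i j else b i j)) != 0.
Proof.
move=> dab.
pose mix k (c : 'I_n -> bool) := \matrix_(i, j)
  (if (i < k)%N then (if c i then a i j else b i j) else a i j + b i j).
suff key k : (k <= n)%N -> exists c, \det (mix k c) != 0.
  have [c hc] := key n (leqnn n); exists c; move: hc; congr (\det _ != 0).
  by apply/matrixP => i j; rewrite !mxE ltn_ord.
elim: k => [_|k IH lt_kn].
  exists xpredT; move: dab; congr (\det _ != 0).
  by apply/matrixP => i j; rewrite !mxE.
have [c hc] := IH (ltnW lt_kn); pose i0 := Ordinal lt_kn.
pose cc t i := if i == i0 then t else c i.
have e : \det (mix k c) = 1 * \det (mix k.+1 (cc true)) + 1 * \det (mix k.+1 (cc false)).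
  apply: (@determinant_multilinear _ _ _ _ _ i0).
  - by apply/rowP => j; rewrite !mxE /= ltnn ltnSn /cc eqxx !mul1r.
  - apply/matrixP => i j; rewrite !mxE /cc eq_sym (negbTE (neq_lift i0 i)) ltnS.
    rewrite leq_eqVlt; have /negbTE -> // : nat_of_ord (lift i0 i) != k.
    by apply/eqP => h; case/eqP: (neq_lift i0 i); apply/val_inj.
  apply/matrixP => i j; rewrite !mxE /cc eq_sym (negbTE (neq_lift i0 i)) ltnS.
  rewrite leq_eqVlt; have /negbTE -> // : nat_of_ord (lift i0 i) != k.
  by apply/eqP => h; case/eqP: (neq_lift i0 i); apply/val_inj.
have [d0|d1] := eqVneq (\det (mix k.+1 (cc true))) 0; last by exists (cc true).
exists (cc false); apply: contraNneq hc => d1.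
by rewrite e d0 d1 !mulr0 addr0.
Qed.

(** * Kernel directions of the differential *)

Section Kernel.

Variables (R : rcfType) (m : nat) (D B : rel 'I_m).
Hypothesis symB : symmetric B.
Notation point := ('M[R]_m * 'M[R]_m)%type.
Notation H x := (htmx x.1 x.2).
Notation Sig x := (phiG x.1 x.2).

(* [d] spans, with the change of [O] that it forces, a direction in which the
   differential of [phiG] vanishes *)
Definition kernel_dir (x : point) (d : 'M[R]_m) : Prop :=
  (forall u w, ~~ D u w -> d u w = 0) /\
  (forall v w, v != w -> ~~ B v w -> (H x *m d) v w + (H x *m d) w v = 0).

(* If only [d = 0] is a kernel direction, some minor of maximal size of the
   system of equations is nonzero. Its rows, indexed by pairs [v, w], split into
   a part in the columns of [pa v] and a part in the columns of [pa w]; choosing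
   one part for each row distributes the pairs into sets [Y v]. *)
Lemma kernel_dir_exists x : HTC_infinite_to_one D B -> preTheta D B x ->
  exists2 d, d != 0 & kernel_dir x d.
Proof.
move=> inf tx; apply: NNPP => nd.
have kd0 d : kernel_dir x d -> d = 0.
  by move=> kd; apply/eqP/negPn/negP => d0; apply: nd; exists d.
(* The unknowns are the entries of [d] on the edges [ED]. The equations [ER] list each pair that is
   not in [B] once, by the condition [e.1 < e.2]. *)
pose ED := [set e : 'I_m * 'I_m | D e.1 e.2].
pose ER := [set e : 'I_m * 'I_m | (e.1 < e.2)%N && ~~ B e.1 e.2].
pose ed (j : 'I_#|ED|) := enum_val j; pose er (i : 'I_#|ER|) := enum_val i.
have edD j : D (ed j).1 (ed j).2 by have := enum_valP j; rewrite inE.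
have erP i : ((er i).1 < (er i).2)%N /\ ~~ B (er i).1 (er i).2.
  by have := enum_valP i; rewrite inE => /andP[].
have ed_inj : injective ed by apply: enum_val_inj.
pose A v w (j : 'I_#|ED|) := ((ed j).2 == w)%:R * H x v (ed j).1.
pose dl (z : 'cV[R]_#|ED|) := \sum_j z j ord0 *: delta_mx (ed j).1 (ed j).2 : 'M_m.
have dlE (z : 'cV[R]_#|ED|) v w : (H x *m dl z) v w = \sum_j A v w j * z j ord0.
  rewrite mulmx_sumr summxE; apply: eq_bigr => j _.
  rewrite -scalemxAr mxE mulrC; congr (_ * _); rewrite mxE (bigD1 (ed j).1) //= big1 => [|u nu].
    by rewrite addr0 [delta_mx _ _ _ _]mxE eqxx /= mulrC eq_sym.
  by rewrite [delta_mx _ _ _ _]mxE (negbTE nu) mulr0.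
have dl_coef z j : dl z (ed j).1 (ed j).2 = z j ord0.
  rewrite summxE (bigD1 j) //= big1 => [|k nk]; first by rewrite !mxE !eqxx mulr1 addr0.
  rewrite !mxE; case: andP => [[/eqP e1 /eqP e2]|_]; last by rewrite mulr0.
  case/eqP: nk; apply: ed_inj; rewrite [LHS]surjective_pairing -e1 -e2.
  by rewrite -surjective_pairing.
have dlD z u w : ~~ D u w -> dl z u w = 0.
  move=> nD; rewrite summxE big1 // => j _; rewrite !mxE.
  case: andP => [[/eqP e1 /eqP e2]|_]; last by rewrite mulr0.
  by move: nD; rewrite e1 e2 edD.
pose J := \matrix_(i, j) (A (er i).1 (er i).2 j + A (er i).2 (er i).1 j).
have J_inj (z : 'cV[R]_#|ED|) : J *m z = 0 -> z = 0.
  move=> Jz; suff d0 : dl z = 0.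
    by apply/colP => j; rewrite -dl_coef d0 !mxE.
  apply: kd0; split=> [|v w]; first exact: dlD.
  have lt_case (a b : 'I_m) : (a < b)%N -> ~~ B a b -> (H x *m dl z) a b + (H x *m dl z) b a = 0.
    move=> ab nB; have abE : (a, b) \in ER by rewrite inE /= ab.
    have e : (J *m z) (enum_rank_in abE (a, b)) ord0 = 0 by rewrite Jz mxE.
    rewrite !dlE -big_split -[RHS]e mxE; apply: eq_bigr => j _.
    by rewrite [J _ _]mxE /er enum_rankK_in //= mulrDl.
  move=> nvw nB; case: (ltngtP v w) => h; first exact: lt_case.
    by rewrite addrC; apply: lt_case => //; rewrite symB.
  by case/eqP: nvw; apply: val_inj.
have fJ : row_full J.
  rewrite /row_full -mxrank_tr; change (row_free J^T); rewrite -kermx_eq0.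
  apply/eqP/row_matrixP => i; rewrite row0; apply: trmx_inj; rewrite trmx0.
  apply: J_inj; apply: trmx_inj; rewrite trmx_mul trmxK trmx0.
  by apply/sub_kermxP; apply: row_sub.
have uJ := fullrowsub_unit fJ; pose f := fullrankfun fJ.
have f_inj : injective f by apply: fullrankfun_inj.
pose a := \matrix_(i, j) A (er (f i)).1 (er (f i)).2 j.
pose b := \matrix_(i, j) A (er (f i)).2 (er (f i)).1 j.
have [c dC] : exists c : 'I_#|ED| -> bool,
    \det (\matrix_(i, j) (if c i then a i j else b i j)) != 0.
  apply: det_row_split; move: uJ; rewrite unitmxE unitfE; congr (\det _ != 0).
  by apply/matrixP => i j; rewrite !mxE.
(* Row [i] comes from the pair of [oth i] and [own i], and it will put [oth i] into the set of
   [own i]. *)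
pose own i := if c i then (er (f i)).2 else (er (f i)).1.
pose oth i := if c i then (er (f i)).1 else (er (f i)).2.
set C := \matrix_(i, j) _ in dC.
have CE i j : C i j = A (oth i) (own i) j.
  by rewrite mxE /oth /own; case: (c i); rewrite mxE.
have no_B i : oth i != own i /\ ~~ B (oth i) (own i).
  have [lt nB] := erP (f i); rewrite /oth /own.
  by case: (c i); rewrite ?[B (er (f i)).2 _]symB nB ?(gtn_eqF lt) ?(ltn_eqF lt);
    split=> //; apply/eqP => e; rewrite e ltnn in lt.
have same_pair i j : own i = own j -> oth i = oth j -> i = j.
  have [lt1 _] := erP (f i); have [lt2 _] := erP (f j); move: lt1 lt2.
  rewrite /own /oth => lt1 lt2 e1 e2; apply: f_inj; apply: enum_val_inj.
  rewrite -/(er _) -/(er _) [LHS]surjective_pairing [RHS]surjective_pairing.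
  case: (c i) (c j) e1 e2 => -[] e1 e2; rewrite ?e1 ?e2 //.
    by move: lt1; rewrite e1 e2 => /(ltn_trans lt2); rewrite ltnn.
  by move: lt1; rewrite e1 e2 => /(ltn_trans lt2); rewrite ltnn.
have swap_pair i j : own i = oth j -> oth i = own j -> i = j.
  have [lt1 _] := erP (f i); have [lt2 _] := erP (f j); move: lt1 lt2.
  rewrite /own /oth => lt1 lt2 e1 e2; apply: f_inj; apply: enum_val_inj.
  rewrite -/(er _) -/(er _) [LHS]surjective_pairing [RHS]surjective_pairing.
  case: (c i) (c j) e1 e2 => -[] e1 e2; rewrite ?e1 ?e2 //.
    by move: lt1; rewrite e1 e2 => /(ltn_trans lt2); rewrite ltnn.
  by move: lt1; rewrite e1 e2 => /(ltn_trans lt2); rewrite ltnn.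
have [s hs] := det_neq0_perm dC.
(* A nonzero term of the determinant matches row [i] with an edge into [own i], so [Y v] gets as
   many elements as [v] has parents. *)
have own_s i : (ed (s i)).2 = own i.
  have [//|ne] := eqVneq (ed (s i)).2 (own i).
  by move: (hs i); rewrite CE /A (negbTE ne) mul0r eqxx.
pose Y v := [set oth i | i in [set i | own i == v]].
have YP v : HTC D B v (Y v).
  have cY : #|Y v| = #|pa D v|.
    rewrite card_in_imset => [|i j]; last first.
      by rewrite !inE => /eqP <- /eqP e; apply: same_pair.
    have -> : pa D v = [set (ed j).1 | j in [set s i | i in [set i | own i == v]]].
      apply/setP => u; rewrite inE; apply/idP/imsetP => [Duv|[_ /imsetP[i ov ->] ->]]; last first.
        by move: ov; rewrite inE -own_s => /eqP <-.
      have uvE : (u, v) \in ED by rewrite inE.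
      pose j := enum_rank_in uvE (u, v).
      have ej : ed j = (u, v) by rewrite /ed enum_rankK_in.
      exists j; last by rewrite ej.
      apply/imsetP; exists (s^-1 j)%g; last by rewrite permKV.
      by rewrite inE -own_s permKV ej.
    rewrite card_in_imset => [|_ _ /imsetP[i oi ->] /imsetP[j oj ->] e].
      by rewrite card_imset //; apply: perm_inj.
    apply: ed_inj; rewrite [LHS]surjective_pairing e [RHS]surjective_pairing !own_s.
    by move: oi oj; rewrite !inE => /eqP -> /eqP ->.
  split=> //.
    apply/setP => w; rewrite !inE; apply/negP => /andP[/imsetP[i]].
    rewrite inE => /eqP <- ->; have [n1 n2] := no_B i.
    by rewrite (negbTE n1) (negbTE n2).
  apply: (htsystem_of_inj tx cY) => z zP zY.
  (* Row [i] of [C] involves only edges into [own i], so [C] is block diagonal along heads of edges,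
     and a kernel vector of the block of [v] extends by zero. *)
  pose zh : 'cV[R]_#|ED| := \col_j (((ed j).2 == v)%:R * z (ed j).1 ord0).
  have zh0 : zh = 0.
    have /det_injP := dC; apply; apply/colP => i; rewrite [RHS]mxE mxE.
    have [ov|nov] := eqVneq (own i) v; last first.
      rewrite big1 // => j _; rewrite CE /A [zh _ _]mxE.
      have [e|ne] := eqVneq (ed j).2 (own i); last by rewrite !mul0r.
      by rewrite e (negbTE nov) mul0r mulr0.
    have yY : oth i \in Y v by apply: imset_f; rewrite inE ov.
    rewrite -[RHS](zY _ yY) mxE.
    transitivity (\sum_(e in ED) (e.2 == v)%:R * (H x (oth i) e.1 * z e.1 ord0)).
      rewrite [RHS]big_enum_val /=; apply: eq_bigr => j _; rewrite CE [zh _ _]mxE /A ov -/(ed j).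
      by case: ((ed j).2 == v); rewrite ?mul1r ?mul0r.
    transitivity (\sum_u \sum_w (if D u w then (w == v)%:R * (H x (oth i) u * z u ord0) else 0)).
      by rewrite pair_bigA big_mkcond; apply: eq_bigr => -[u w] _; rewrite inE.
    apply: eq_bigr => u _; rewrite (bigD1 v) //= big1 => [|w nw].
      rewrite addr0 eqxx mul1r; case: ifPn => // nD.
      by rewrite (zP u) ?mulr0 // inE.
    by rewrite (negbTE nw) mul0r; case: ifP.
  apply/colP => u; rewrite [RHS]mxE; have [uP|/zP //] := boolP (u \in pa D v).
  have uvE : (u, v) \in ED by move: uP; rewrite !inE.
  have /colP/(_ (enum_rank_in uvE (u, v))) := zh0.
  by rewrite !mxE /ed enum_rankK_in //= eqxx mul1r.
(* A mutual pair would come from two rows with the same unordered pair, hence from a single row [i]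
   with [own i = oth i]. *)
case: (inf Y) => [[v]|[v [w [nvw /imsetP[i]]]]]; first by apply; apply: YP.
rewrite inE => /eqP <- vE /imsetP[j]; rewrite inE vE => /eqP oj wE.
have e := swap_pair _ _ wE (esym oj); subst j.
by case: (no_B i); rewrite wE eqxx.
Qed.

End Kernel.

(** * First-order calculus along a line *)

Section Congruence.

Variables (R : rcfType) (a : {poly R}).

(* congruence modulo [s ^+ 2] in the localization at [a] *)
Definition cong2 (g : R -> R) (c : {poly R}) : Prop :=
  exists (N : nat) (r : {poly R}), forall s, a.[s] != 0 ->
    a.[s] ^+ N * (g s - c.[s]) = s ^+ 2 * r.[s].

Lemma cong2_poly c : cong2 (fun s => c.[s]) c.
Proof. by exists 0%N, 0 => s _; rewrite subrr horner0 !mulr0. Qed.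

Lemma cong2_add g h c d : cong2 g c -> cong2 h d -> cong2 (fun s => g s + h s) (c + d).
Proof.
move=> [N [r hr]] [M [q hq]]; exists (N + M)%N, (a ^+ M * r + a ^+ N * q) => s ns.
have h1 := hr s ns; have h2 := hq s ns.
rewrite !hornerE exprD.
transitivity (a.[s] ^+ M * (a.[s] ^+ N * (g s - c.[s])) + a.[s] ^+ N * (a.[s] ^+ M * (h s - d.[s]))).
  by ring.
by rewrite h1 h2; ring.
Qed.

Lemma cong2_mul g h c d : cong2 g c -> cong2 h d -> cong2 (fun s => g s * h s) (c * d).
Proof.
move=> [N [r hr]] [M [q hq]].
exists (N + M)%N, (a ^+ M * r * d + a ^+ N * q * c + 'X ^+ 2 * r * q) => s ns.
have h1 := hr s ns; have h2 := hq s ns.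
rewrite !hornerE exprD.
transitivity (a.[s] ^+ M * (a.[s] ^+ N * (g s - c.[s])) * d.[s]
  + a.[s] ^+ N * (a.[s] ^+ M * (h s - d.[s])) * c.[s]
  + (a.[s] ^+ N * (g s - c.[s])) * (a.[s] ^+ M * (h s - d.[s]))).
  by ring.
by rewrite h1 h2; ring.
Qed.

Lemma poly_eq_fun (p q : {poly R}) : (forall s, p.[s] = q.[s]) -> p = q.
Proof.
move=> h; apply/eqP; rewrite -subr_eq0; apply/negPn/negP => n0.
have [s [_ _]] := nonroot_itv n0 (@ltr01 R).
by rewrite hornerD hornerN h subrr eqxx.
Qed.

(** The hypotheses make [c] times a power of [a] divisible by ['X ^+ 2]; as [a] is nonzero at 0, [c]
    has a double zero there. *)
Lemma cong2_deriv g c : a.[0] != 0 -> cong2 g c -> (forall s, a.[s] != 0 -> g s = 0) ->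
  c^`().[0] = 0.
Proof.
move=> na [N [r hr]] g0.
(* The extra factor [a] extends the identity to the zeros of [a], hence to an identity of
   polynomials. *)
have e : a ^+ N.+1 * c = - ('X ^+ 2 * (r * a)).
  apply: poly_eq_fun => s; rewrite hornerM hornerN !hornerM !horner_exp hornerX.
  have [a0|a1] := eqVneq a.[s] 0; first by rewrite a0 expr0n /= mul0r !mulr0 oppr0.
  have := hr s a1; rewrite g0 // sub0r mulrN => /eqP; rewrite eqr_oppLR => /eqP h.
  by rewrite [a.[s] ^+ N.+1]exprS -[a.[s] * _ * _]mulrA h; ring.
have c0 : c.[0] = 0.
  have := congr1 (horner^~ 0) e.
  rewrite /= hornerM hornerN hornerM !horner_exp hornerX expr0n /= mul0r oppr0.
  by move/eqP; rewrite mulf_eq0 expf_eq0 (negbTE na) andbF /= => /eqP.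
have := congr1 (fun p : {poly R} => p^`().[0]) e.
rewrite /= derivM derivN derivM derivXn !hornerE c0 /=.
rewrite ?expr0n /= ?expr1 ?mulr0 ?mul0r ?mul0rn ?mul0r ?add0r ?oppr0.
by move/eqP; rewrite mulf_eq0 expf_eq0 (negbTE na) andbF /= => /eqP.
Qed.

End Congruence.

Lemma conj_invmx (F : comUnitRingType) n (A S W : 'M[F]_n) c : A \in unitmx ->
  (invmx A)^T *m (A^T *m S *m A - c *: W) *m invmx A
  = S - c *: ((invmx A)^T *m W *m invmx A).
Proof.
move=> uA; rewrite mulmxBr mulmxBl -scalemxAr -scalemxAl; congr (_ - _).
by rewrite !mulmxA -trmx_mul mulmxV // trmx1 mul1mx -mulmxA mulmxV // mulmx1.
Qed.

(** * Relations between the covariance matrix and one coefficient *)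

Section Tangent.

Variables (R : rcfType) (m : nat) (D B : rel 'I_m).
Notation point := ('M[R]_m * 'M[R]_m)%type.
Notation H x := (htmx x.1 x.2).
Notation Sig x := (phiG x.1 x.2).
Notation mvar := ('I_m * 'I_m)%type.

Definition at_cov (x : point) (z : R) (P : mpoly R (option mvar)) : R :=
  meval (opt (matrix_coord (Sig x)) z) P.

Definition at_cov_L u v (x : point) P : R := at_cov x (x.1 u v) P.

(* Along a kernel direction the covariance matrix is constant up to second
   order, so a relation between it and [L u v] can be differentiated in [L u v]
   alone. *)
Lemma kernel_dir_relation x d Q u v : preTheta D B x -> kernel_dir D B x d ->
  (forall y, preTheta D B y -> at_cov_L u v y Q = 0) ->
  d u v * (uni (matrix_coord (Sig x)) Q)^`().[x.1 u v] = 0.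
Proof.
move=> tx [dD dB] hQ; have [[DL uL] sO BO] := tx.
(* [dO] is the derivative of [(1 - L)^T S (1 - L)] in direction [d] with [S] fixed; [kernel_dir]
   makes it respect the zero pattern of [O]. *)
pose A := 1%:M - x.1; pose dO := - (H x *m d + (H x *m d)^T).
pose y s : point := (x.1 + s *: d, x.2 + s *: dO).
pose As s := A - s *: d.
have AsE s : 1%:M - (y s).1 = As s by rewrite /As /A /= opprD addrA.
pose Ap : 'M[{poly R}]_m := \matrix_(i, j) ((A i j)%:P - 'X * (d i j)%:P).
have ApE s : map_mx (horner_eval s) Ap = As s.
  by apply/matrixP => i j; rewrite !mxE /horner_eval !hornerE.
pose a := \det Ap.
have aE s : a.[s] = \det (As s) by rewrite -ApE det_map_mx.
have As0 : As 0 = A by rewrite /As scale0r subr0.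
have ty s : a.[s] != 0 -> preTheta D B (y s).
  move=> ns; split; first split.
  - by move=> i j nD; rewrite !mxE DL // dD // mulr0 addr0.
  - by rewrite AsE unitmxE unitfE -aE.
  - rewrite /= linearD linearZ /= sO; congr (_ + _ *: _).
    by rewrite /dO linearN linearD /= trmxK addrC.
  move=> i j nij nB; rewrite /= mxE BO // add0r mxE /dO mxE mxE [_^T _ _]mxE.
  by rewrite dB // oppr0 mulr0.
pose W := d^T *m Sig x *m d.
(* The quadratic term [W] is the whole error, so [Sig (y s)] and [Sig x] differ by [s ^+ 2] times a
   matrix whose denominators are powers of [a]. *)
have OE s : (y s).2 = (As s)^T *m Sig x *m As s - s ^+ 2 *: W.
  have e1 : A^T *m Sig x = H x by apply: phi_ht.
  have e2 : Sig x *m A = (H x)^T.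
    by rewrite -e1 trmx_mul trmxK phi_sym.
  have e3 : A^T *m Sig x *m A = x.2 by apply: phi_cov.
  have e4 : (As s)^T = A^T - s *: d^T by rewrite linearB linearZ.
  have e5 : d^T *m Sig x *m A = (H x *m d)^T by rewrite -mulmxA e2 [RHS]trmx_mul.
  rewrite e4 mulmxBl {1}/As mulmxBr !mulmxBl e3 e1 -!scalemxAr -!scalemxAl e5 -/W /= /dO.
  apply/matrixP => i j; rewrite !mxE; move: (\sum_j _) (\sum_j _) (\sum_j _) => p q r.
  by ring.
have cS i j : cong2 a (fun s => Sig (y s) i j) (Sig x i j)%:P.
  pose K : 'M[{poly R}]_m := (\adj Ap)^T *m map_mx polyC W *m \adj Ap.
  exists 2, (- K i j) => s ns; rewrite hornerC hornerN.
  have uA : As s \in unitmx by rewrite unitmxE unitfE -aE.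
  have KE : (K i j).[s] = ((\adj (As s))^T *m W *m \adj (As s)) i j.
    have -> : (K i j).[s] = map_mx (horner_eval s) K i j by rewrite [RHS]mxE.
    rewrite /K 2!map_mxM -map_trmx map_mx_adj ApE; congr ((_ *m _ *m _) i j).
    by apply/matrixP => k l; rewrite [LHS]mxE [map_mx _ W k l]mxE /= horner_evalE hornerC.
  have eS : Sig (y s) - Sig x = - s ^+ 2 *: ((invmx (As s))^T *m W *m invmx (As s)).
    by rewrite {1}/phiG AsE OE conj_invmx // addrC addKr scaleNr.
  have -> : Sig (y s) i j - Sig x i j = (Sig (y s) - Sig x) i j by rewrite !mxE.
  have iE : invmx (As s) = a.[s]^-1 *: \adj (As s) by rewrite /invmx uA aE.
  have iT : (invmx (As s))^T = a.[s]^-1 *: (\adj (As s))^T by rewrite iE linearZ.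
  rewrite eS KE iT iE -!scalemxAl -scalemxAr !scalerA mxE; field.
  exact: ns.
(* The covariance is frozen at [Sig x] and only the coefficient moves; the chain rule then produces
   the factor [d u v]. *)
pose c := (uni (matrix_coord (Sig x)) Q) \Po ((x.1 u v)%:P + d u v *: 'X).
have kc : cong2 a (fun s => at_cov_L u v (y s) Q) c.
  rewrite /c /at_cov_L /at_cov; elim: (Q) => /= [k|[[i j]|]|p IHp q IHq|p IHp q IHq].
  - rewrite comp_polyC; apply: (_ : cong2 a (fun s => k) k%:P).
    by have [N [r h]] := cong2_poly a k%:P; exists N, r => s /h; rewrite hornerC.
  - by rewrite comp_polyC; apply: cS.
  - rewrite comp_polyX; have [N [r h]] := cong2_poly a ((x.1 u v)%:P + d u v *: 'X).
    by exists N, r => s /h; rewrite !mxE !hornerE [s * _]mulrC.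
  - by rewrite comp_polyD; apply: cong2_add.
  - by rewrite comp_polyM; apply: cong2_mul.
have na : a.[0] != 0 by rewrite aE As0 -unitfE -unitmxE.
have := cong2_deriv na kc (fun s ns => hQ _ (ty s ns)).
rewrite /c deriv_comp derivD derivC derivZ derivX add0r hornerM horner_comp.
by rewrite hornerD !hornerZ hornerX !hornerC mulr0 addr0 mulr1 mulrC.
Qed.

Fixpoint mderiv (p : mpoly R (option mvar)) : mpoly R (option mvar) :=
  match p with
  | MPconst _ => MPconst _ 0
  | MPvar o => MPconst _ (if o is Some _ then 0 else 1)
  | MPadd p q => MPadd (mderiv p) (mderiv q)
  | MPmul p q => MPadd (MPmul (mderiv p) q) (MPmul p (mderiv q))
  end.

Lemma uni_mderiv e p : uni e (mderiv p) = (uni e p)^`().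
Proof.
elim: p => /= [c|[x|]|p IHp q IHq|p IHp q IHq].
- by rewrite derivC.
- by rewrite derivC.
- by rewrite derivX.
- by rewrite derivD IHp IHq.
- by rewrite derivM IHp IHq.
Qed.

Lemma at_cov_uni x z P : at_cov x z P = (uni (matrix_coord (Sig x)) P).[z].
Proof. by rewrite uniE. Qed.

Lemma regfn_at_cov z P : regfn D B (fun x => at_cov x z P).
Proof.
apply: (rc_meval (@regfn_closed R m D B)) => -[[i j]|] /=; first exact: regfn_phi.
exact: (rc_const (@regfn_closed R m D B)).
Qed.

Lemma regfn_at_cov_L u v P : regfn D B (fun x => at_cov_L u v x P).
Proof.
apply: (rc_meval (@regfn_closed R m D B)) => -[[i j]|] /=; first exact: regfn_phi.
exact: regfn_L.
Qed.

Lemma derivn_lead (p : {poly R}) z : p != 0 -> (p^`((size p).-1)).[z] != 0.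
Proof.
move=> p0; have -> : p^`((size p).-1) = (lead_coef p *+ (size p).-1`!)%:P.
  apply/polyP => i; rewrite coef_derivn coefC; case: i => [|i] /=.
    by rewrite addn0 ffactnn.
  rewrite nth_default ?mul0rn // addnS.
  by move: p0; rewrite -size_poly_gt0; case: (size p) => // n _; rewrite ltnS leq_addr.
by rewrite hornerC mulrn_eq0 negb_or lead_coef_eq0 p0 -lt0n fact_gt0.
Qed.

Definition vanishes u v P : Prop := forall x, preTheta D B x -> at_cov_L u v x P = 0.

(** If differentiation preserved vanishing forever, the last derivative of the relation at [x0], a
    nonzero constant as in [derivn_lead], would vanish too. *)
Lemma minimal_relation u v P x0 : preTheta D B x0 -> uni (matrix_coord (Sig x0)) P != 0 ->
  vanishes u v P -> exists Q, vanishes u v Q /\ ~ vanishes u v (mderiv Q).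
Proof.
move=> t0 nP vP; apply: NNPP => nQ.
have all_v k : vanishes u v (iter k mderiv P).
  by elim: k => //= k IH; apply: NNPP => n; apply: nQ; exists (iter k mderiv P).
have e k : uni (matrix_coord (Sig x0)) (iter k mderiv P) = (uni (matrix_coord (Sig x0)) P)^`(k).
  elim: k => [|k IH]; first by rewrite derivn0.
  by rewrite derivnS -IH -uni_mderiv.
case/eqP: (derivn_lead (x0.1 u v) nP); rewrite -e -at_cov_uni.
exact: all_v.
Qed.

(* Otherwise take, for every edge, a relation whose derivative does not vanish
   identically: at a generic point this leaves no kernel direction. *)
Lemma transcendental_edge (P : 'I_m -> 'I_m -> mpoly R (option mvar)) :
  (forall x : point, preTheta D B x -> exists2 d, d != 0 & kernel_dir D B x d) ->
  (forall u v, exists2 x : point, preTheta D B x & uni (matrix_coord (Sig x)) (P u v) != 0) ->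
  exists u v, exists2 x : point, preTheta D B x & at_cov_L u v x (P u v) != 0.
Proof.
move=> ker hP; apply: NNPP => nP.
have vP u v : vanishes u v (P u v).
  move=> x tx; apply: NNPP => n; apply: nP; exists u, v, x => //; exact/eqP.
have rel (e : mvar) : exists Q, vanishes e.1 e.2 Q /\ ~ vanishes e.1 e.2 (mderiv Q).
  by have [x tx nx] := hP e.1 e.2; apply: minimal_relation nx (vP _ _).
have [Q hQ] := fin_all_exists rel.
have [||x tx hx] := @dense_prod R m D B _ (index_enum mvar)
  (fun e x => at_cov_L e.1 e.2 x (mderiv (Q e))) (fun e _ => regfn_at_cov_L e.1 e.2 _).
- move=> e _; have [_ n] := hQ e; apply: NNPP => h; apply: n => x tx.
  by apply/eqP/negPn/negP => nx; apply: h; exists x.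
- by exists (0, 1%:M); apply: preTheta1.
have [d d0 kd] := ker x tx; case/eqP: d0; apply/matrixP => u v; rewrite [RHS]mxE.
have := kernel_dir_relation tx kd (proj1 (hQ (u, v))).
rewrite -uni_mderiv -at_cov_uni => /eqP; rewrite mulf_eq0 => /orP[/eqP //|].
by have := hx (u, v) (mem_index_enum _); rewrite /at_cov_L /= => /negbTE ->.
Qed.

(** [P] is the product of those [q] in [qs] that are nonzero in the distinguished variable at some
    point; every other [q] satisfies the first alternative of [generic] at all points. *)
Lemma generic_poly qs : exists P,
  (exists2 x : point, preTheta D B x & uni (matrix_coord (Sig x)) P != 0) /\
  forall (x : point) z, preTheta D B x -> at_cov x z P != 0 -> generic (matrix_coord (Sig x)) z qs.
Proof.
have nonroot (p : {poly R}) : p != 0 -> exists z, p.[z] != 0.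
  by move=> /nonroot_itv/(_ (@ltr01 R))[s [_ _]]; exists s.
elim: qs => [|q qs [P [[x tx nx] gP]]].
  exists (MPconst _ 1); split; last by move=> x z _ _ q [].
  exists (0, 1%:M); first exact: preTheta1.
  by rewrite /= polyC_eq0 oner_neq0.
case: (classic (exists2 y : point, preTheta D B y & uni (matrix_coord (Sig y)) q != 0)); last first.
  move=> triv; exists P; split; first by exists x.
  move=> y z ty nz p [<-|pq]; last exact: gP nz _ pq.
  by left; apply/eqP/negPn/negP => nq; apply: triv; exists y.
move=> [y ty ny]; exists (MPmul q P); split; last first.
  move=> w z tw; rewrite /at_cov /= mulf_eq0 negb_or => /andP[h1 h2] p [<-|pq].
    by right; rewrite uniE.
  exact: gP h2 _ pq.
have [z1 h1] := nonroot _ ny; have [z2 h2] := nonroot _ nx.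
have [||w tw nw] := dense_mul (regfn_at_cov z1 q) (regfn_at_cov z2 P).
- by exists y; rewrite ?at_cov_uni.
- by exists x; rewrite ?at_cov_uni.
exists w => //=; move: nw; rewrite !at_cov_uni !mulf_eq0 !negb_or => /andP[n1 n2].
by apply/andP; split; [apply: contraNneq n1 | apply: contraNneq n2] => ->; rewrite horner0.
Qed.

End Tangent.

(** * Fibers described by polynomial equations *)

Section Fibers.

Variables (R : rcfType) (m : nat) (D B : rel 'I_m).
Hypothesis symB : symmetric B.
Notation point := ('M[R]_m * 'M[R]_m)%type.
Notation Sig x := (phiG x.1 x.2).
Notation mvar := ('I_m * 'I_m)%type.
Notation aux := (mvar + unit)%type.

(** A point of the fiber over [S] is determined by [L], since [O] must be [(1 - L)^T S (1 - L)].
    Positive definiteness of that matrix follows by congruence in [fiber_point]. *)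
Definition fiber_at (u v : 'I_m) (S : 'M[R]_m) (z : R) (L : 'M[R]_m) : Prop :=
  [/\ in_RDreg D L,
      forall i j, i != j -> ~~ B i j -> ((1%:M - L)^T *m S *m (1%:M - L)) i j = 0
    & L u v = z].

Lemma in_map_all (I : eqType) (T : Type) (s : seq I) (f : I -> T) (P : T -> Prop) :
  (forall x, List.In x (map f s) -> P x) <-> (forall i, i \in s -> P (f i)).
Proof.
elim: s => [|i s IH] /=; first by split=> // _ x [].
split=> [h j|h x [<-|xs]].
- rewrite inE => /orP[/eqP ->|js]; first by apply: h; left.
  by move: j js; apply/IH => x xs; apply: h; right.
- by apply: h; rewrite mem_head.
- by move: x xs; apply/IH => j js; apply: h; rewrite inE js orbT.
Qed.

(* the auxiliary variables are the entries of [L] and an inverse of [det (1 - L)] *)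
Lemma fiber_solvable u v : exists Es : seq (mpoly R (option mvar + aux)),
  forall S z, solvable_at Es (matrix_coord S) z <-> exists L, fiber_at u v S z L.
Proof.
pose E := option mvar + aux -> R; pose c (e : E) := e.
have cl : ring_closed (polyfn c) := polyfn_closed c.
pose Lm (e : E) : 'M[R]_m := \matrix_(i, j) e (inr (inl (i, j))).
pose Sm (e : E) : 'M[R]_m := \matrix_(i, j) e (inl (Some (i, j))).
have kL : mx_in (polyfn c) Lm.
  by move=> i j; apply: (rc_ext cl _ (polyfn_var c (inr (inl (i, j))))) => e; rewrite mxE.
have kS : mx_in (polyfn c) Sm.
  by move=> i j; apply: (rc_ext cl _ (polyfn_var c (inl (Some (i, j))))) => e; rewrite mxE.
have kI : mx_in (polyfn c) (fun e => 1%:M - Lm e).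
  by apply: (rc_submx cl) => //; apply: (rc_cstmx cl).
have kO : mx_in (polyfn c) (fun e => (1%:M - Lm e)^T *m Sm e *m (1%:M - Lm e)).
  by apply: (rc_mulmx cl) => //; apply: (rc_mulmx cl) => //; apply: (rc_trmx cl).
have [p2 h2] : polyfn c (fun e => \det (1%:M - Lm e) * e (inr (inr tt)) - 1).
  apply: (rc_sub cl); last exact: (rc_const cl).
  by apply: (rc_mul cl); [apply: (rc_det cl) | apply: polyfn_var].
have [p4 h4] : polyfn c (fun e => Lm e u v - e (inl None)).
  by apply: (rc_sub cl); [apply: kL | apply: polyfn_var].
have /fin_all_exists[p1 h1] (ij : mvar) : polyfn c (fun e =>
    if D ij.1 ij.2 then 0 else Lm e ij.1 ij.2).
  by case: (D _ _); [exact: (rc_const cl) | exact: kL].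
have /fin_all_exists[p3 h3] (ij : mvar) : polyfn c (fun e =>
    if (ij.1 == ij.2) || B ij.1 ij.2 then 0
    else ((1%:M - Lm e)^T *m Sm e *m (1%:M - Lm e)) ij.1 ij.2).
  by case: (_ || _); [exact: (rc_const cl) | exact: kO].
exists (p2 :: p4 :: map p1 (enum {: mvar}) ++ map p3 (enum {: mvar})) => S z.
pose ev (w : aux -> R) : E := fun x =>
  match x with inl o => opt (matrix_coord S) z o | inr q => w q end.
have SmE w : Sm (ev w) = S by apply/matrixP => i j; rewrite mxE.
split=> [[w hw]|[L [[DL uL] hL Lz]]].
  have hw' p : List.In p (p2 :: p4 :: map p1 (enum {: mvar}) ++ map p3 (enum {: mvar})) ->
    meval (c (ev w)) p = 0 := hw p.
  exists (Lm (ev w)); split; first split.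
  - move=> i j nD.
    have : meval (c (ev w)) (p1 (i, j)) = 0.
      apply: hw'; right; right; apply: List.in_or_app; left.
      have /in_map_all : forall x, List.In x [seq p1 i | i <- enum {: mvar}] ->
        List.In x [seq p1 i | i <- enum {: mvar}] by [].
      by apply; rewrite mem_enum.
    by rewrite h1 /= (negbTE nD).
  - rewrite unitmxE unitfE; apply/eqP => d0.
    have /hw' : List.In p2 (p2 :: p4 :: map p1 (enum {: mvar}) ++ map p3 (enum {: mvar})) by left.
    by rewrite h2 d0 mul0r sub0r => /eqP; rewrite oppr_eq0 oner_eq0.
  - move=> i j nij nB.
    have : meval (c (ev w)) (p3 (i, j)) = 0.
      apply: hw'; right; right; apply: List.in_or_app; right.
      have /in_map_all : forall x, List.In x [seq p3 i | i <- enum {: mvar}] ->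
        List.In x [seq p3 i | i <- enum {: mvar}] by [].
      by apply; rewrite mem_enum.
    by rewrite h3 /= (negbTE nij) (negbTE nB) SmE.
  have /hw' : List.In p4 (p2 :: p4 :: map p1 (enum {: mvar}) ++ map p3 (enum {: mvar})).
    by right; left.
  by rewrite h4 => /eqP; rewrite subr_eq0 => /eqP.
pose w (q : aux) := match q with inl ij => L ij.1 ij.2 | inr _ => (\det (1%:M - L))^-1 end.
have LmE : Lm (ev w) = L by apply/matrixP => i j; rewrite mxE.
exists w => p hp; change (meval (c (ev w)) p = 0); move: p hp.
move=> p [<-|[<-|/(List.in_app_or _ _ _)[]]].
- by rewrite h2 LmE /= divff ?subrr // -unitfE -unitmxE.
- by rewrite h4 LmE /= Lz subrr.
- move: p; apply/in_map_all => -[i j] _; rewrite h1 LmE /=.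
  by case: ifPn => // nD; rewrite DL.
move: p; apply/in_map_all => -[i j] _; rewrite h3 LmE SmE /=.
by case: ifPn => //; rewrite negb_or => /andP[n1 n2]; rewrite hL.
Qed.

Lemma fiber_point L O u v z L' : in_Theta D B L O -> fiber_at u v (phiG L O) z L' ->
  let O' := (1%:M - L')^T *m phiG L O *m (1%:M - L') in
  in_Theta D B L' O' /\ phiG L' O' = phiG L O.
Proof.
move=> [[DL uL] [sO BO pO]] [[DL' uL'] hO' _] O'; split; last first.
  rewrite {1}/phiG /O' !mulmxA -trmx_mul mulmxV // trmx1 mul1mx.
  by rewrite -mulmxA mulmxV // mulmx1.
split=> //; split=> //.
  by rewrite /O' trmx_mul [(_^T *m phiG L O)^T]trmx_mul trmxK phi_sym // mulmxA.
move=> x nx; pose y := invmx (1%:M - L) *m ((1%:M - L') *m x).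
have ny : y != 0.
  apply: contra_neq nx => y0.
  by rewrite -(mulKmx uL' x) -(mulKVmx uL ((1%:M - L') *m x)) -/y y0 !mulmx0.
have -> : x^T *m O' *m x = y^T *m O *m y by rewrite /y /O' /phiG !trmx_mul !mulmxA.
exact: pO.
Qed.

Lemma HTC_generically_infinite_to_one :
  HTC_infinite_to_one D B -> generically_infinite_to_one R D B.
Proof.
move=> inf.
have /fin_all_exists[Es hEs] (e : mvar) := fiber_solvable e.1 e.2.
have /fin_all_exists[qs hqs] (e : mvar) := solvable_at_stable (Es e).
have /fin_all_exists[P hP] (e : mvar) := @generic_poly R m D B (qs e).
have [||u [v ex]] := @transcendental_edge R m D B (fun u v => P (u, v)).
- by move=> x tx; apply: (kernel_dir_exists symB).
- by move=> u v; have [] := hP (u, v).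
have kh := regfn_at_cov_L D B u v (P (u, v)).
have [L0 [O0 [T0 h0]]] := dense_Theta kh ex.
have [N [p [[w hw] hp]]] := kh.
exists [:: w]; split.
  exists L0, O0; split=> //; rewrite /outside_alg /= orbF.
  have := hp (L0, O0) (Theta_preTheta T0); rewrite -hw => e.
  rewrite -[meval _ _]e mulf_neq0 // expf_neq0 //.
  exact: (detL_neq0 (Theta_preTheta T0)).
move=> L O tLO; rewrite /outside_alg /= orbF => nw s.
have tx := Theta_preTheta tLO.
have nh : at_cov_L u v (L, O) (P (u, v)) != 0.
  have := hp (L, O) tx; rewrite -hw => e.
  by move: nw; rewrite -[meval _ _]e mulf_eq0 negb_or => /andP[].
have gen := proj2 (hP (u, v)) (L, O) _ tx nh.
have [[DL uL] [sO BO pO]] := tLO.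
have sol : solvable_at (Es (u, v)) (matrix_coord (phiG L O)) (L u v).
  apply/hEs; exists L; split=> // i j nij nB.
  by rewrite phi_cov // BO.
have [d d0 hd] := hqs (u, v) _ _ sol gen.
(* The roots of [q] are the values at [u v] of the [L]-parts in the given list; a nonroot in the
   interval of solvability yields a fiber point outside the list. *)
pose q := \prod_(a <- [seq LO.1 u v | LO : point <- s]) ('X - a%:P).
have nq : q != 0 by apply: monic_neq0; apply: monic_prod_XsubC.
have lt : L u v < L u v + d by rewrite ltrDl.
have [z [z1 z2 qz]] := nonroot_itv nq lt.
have /hEs[L' fL'] : solvable_at (Es (u, v)) (matrix_coord (phiG L O)) z.
  by apply: hd; rewrite ger0_norm ?ltrBlDl // subr_ge0 ltW.
exists (L', (1%:M - L')^T *m phiG L O *m (1%:M - L')); split.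
  exact: (fiber_point tLO fL').
have [_ _ eL'] := fL'.
apply: contra qz => in_s; rewrite -/(root q z) /q root_prod_XsubC -eL'.
by apply/mapP; exists (L', (1%:M - L')^T *m phiG L O *m (1%:M - L')).
Qed.

End Fibers.

Theorem mainTheorem6 (R : rcfType) (m : nat) (D B : rel 'I_m) :
  mixed_graph D B ->
  [/\ (weak_HTC_identifiable D B -> rationally_identifiable R D B),
      (weak_HTC_identifiable D B <-> HTC_identifiable D B),
      (weak_HTC_infinite_to_one D B -> generically_infinite_to_one R D B) &
      (weak_HTC_infinite_to_one D B <-> HTC_infinite_to_one D B)].
Proof.
move=> [_ [_ symB]]; have e1 := @weak_HTC_identifiableE m D B symB.
have e2 := @weak_HTC_infinite_to_oneE m D B symB; split=> //.
  by move=> /e1[Y [prec [h1 h2 h3]]]; apply: (HTC_rationally_identifiable R symB h1 h2 h3).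
by move=> /e2; apply: HTC_generically_infinite_to_one.
Qed.
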